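(* Suppose that the restriction of $\phi$ to $(0,\infty)$ is absolutely continuous with respect to Lebesgue measure, with a strictly positive density, also denoted $\phi$. Here all comparability constants are independent of $x,y>0$. (1) If $x\le y\le5x$, then $q(x,y)\asymp q(y,x)\asymp x^{-1-\alpha}\asymp y^{-1-\alpha}$. (2) Suppose $\phi$ satisfies the lower weak scaling condition $L_1(\beta_1)$ at zero with $\beta_1>-1-\alpha$. Then for $5x\le y$, $$q(y,x)\asymp(y-x)^{-1-\alpha}\int_{\frac{x}{y-x}}^1\phi(t)\frac{dt}{t}\asymp y^{-1-\alpha}\int_{\frac{x}{y-x}}^1\phi(t)\frac{dt}{t}.$$ Further, if $\phi$ also satisfies the upper weak scaling condition $U_1(\beta_2)$ at zero with $\beta_2<0$, then for $5x\le y$, $$q(y,x)\asymp(y-x)^{-1-\alpha}\phi\Big(\frac{x}{y-x}\Big)\asymp y^{-1-\alpha}\phi\Big(\frac xy\Big).$$ (3) Suppose $\phi$ satisfies the upper weak scaling condition $U^1(\gamma_2)$ at infinity with $\gamma_2<0$. Then for $5x\le y$, $$q(x,y)\asymp(y-x)^{-1-\alpha}\int_0^{\frac{y-x}{x}}t^{\alpha}\phi(t)\,dt\asymp y^{-1-\alpha}\int_1^{\frac yx-1}t^{\alpha}\phi(t)\,dt.$$ Further, if $\phi$ also satisfies the lower weak scaling condition $L^1(\gamma_1)$ at infinity with $\gamma_1>-1-\alpha$, then for $5x\le y$, $$q(x,y)\asymp(y-x)^{-1-\alpha}\Big(\frac{x}{y-x}\Big)^{-1-\alpha}\phi\Big(\frac{y-x}{x}\Big)\asymp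 x^{-1-\alpha}\phi\Big(\frac yx\Big).$$
   Context: Parameters: $(\alpha,\rho)$ is a permissible pair, meaning $\alpha\in(0,1),\rho\in(0,1)$; or $\alpha\in(1,2),\rho\in(1-1/\alpha,1/\alpha)$; or $(\alpha,\rho)=(1,1/2)$. Put $\widehat\rho=1-\rho$ and $c_-=\dfrac{\Gamma(\alpha+1)}{\Gamma(\alpha\widehat\rho)\Gamma(1-\alpha\widehat\rho)}>0$. $\phi$ is a Borel probability measure on $[0,\infty)$. The resurrection kernel is $q(x,A)=\int_{-\infty}^0c_-(x-z)^{-1-\alpha}\phi(|z|^{-1}A)\,dz$ for $x>0$ and Borel $A\subset(0,\infty)$; its density with respect to Lebesgue measure is $$q(x,y)=c_-\int_{(0,\infty)}\Big(x+\frac yt\Big)^{-1-\alpha}t^{-1}\phi(dt),\qquad x,y>0.$$ Weak scaling conditions for $g:(0,\infty)\to(0,\infty)$ and $\beta_1,\beta_2\in\mathbb R$. $L_1(\beta_1)$ (resp. $L^1(\beta_1)$): there is $c\in(0,1]$ with $g(R)/g(r)\ge c(R/r)^{\beta_1}$ for all $0<r\le R<1$ (resp. all $1\le r\le R$). $U_1(\beta_2)$ (resp. $U^1(\beta_2)$): there is $C\in[1,\infty)$ with $g(R)/g(r)\le C(R/r)^{\beta_2}$ for all $0<r\le R<1$ (resp. all $1\le r\le R$). $f\asymp g$ means $k^{-1}g\le f\le kg$ on the indicated range for some constant $k\in(0,\infty)$. *)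

(* Defs.v *)
From HB Require Import structures.
From mathcomp Require Import all_boot all_order all_algebra.
From mathcomp Require Import all_classical all_reals all_analysis.

Set Implicit Arguments.
Unset Strict Implicit.
Unset Printing Implicit Defensive.

Import Order.TTheory GRing.Theory Num.Theory.
Import numFieldNormedType.Exports.

Local Open Scope classical_set_scope.
Local Open Scope ring_scope.

Section Definitions.
Variable R : realType.
Implicit Types (alpha rho b x y : R) (f g : R -> R).

Definition permissible alpha rho : Prop :=
  [\/ (0 < alpha < 1) /\ (0 < rho < 1),
      (1 < alpha < 2) /\ (1 - alpha^-1 < rho < alpha^-1)
    | alpha = 1 /\ rho = 2^-1].

(* Euler's integral; it is the Gamma function for s > 0, the only range in
   which it is used. *)
Definition Gamma (s : R) : R :=
  \int[lebesgue_measure]_(t in `]0, +oo[) (t `^ (s - 1) * expR (- t)).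

Definition c_minus alpha rho : R :=
  let rho_hat := 1 - rho in
  Gamma (alpha + 1) / (Gamma (alpha * rho_hat) * Gamma (1 - alpha * rho_hat)).

(* The density q(x, y), for x, y > 0, of the resurrection kernel
     q(x, A) = \int_(z < 0) c_- (x - z)^(-1-alpha) phi(|z|^-1 A) dz
   for A included in ]0, +oo[; an atom of phi at 0 does not contribute. *)
Definition resurrection_density alpha rho
    (phi : set (measurableTypeR R) -> \bar R) x y : \bar R :=
  ((c_minus alpha rho)%:E *
   \int[phi]_(t in `]0%R, +oo[) ((x + y / t) `^ (- 1 - alpha) * t^-1)%:E)%E.

(* The restriction of phi to ]0, +oo[ is absolutely continuous with respect to
   Lebesgue measure, with strictly positive density f; the values of f on
   ]-oo, 0] are irrelevant. *)
Definition positive_density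
    (phi : set (measurableTypeR R) -> \bar R) f : Prop :=
  [/\ measurable_fun (`]0, +oo[ : set R) f,
      forall t, 0 < t -> 0 < f t
    & forall A : set (measurableTypeR R), measurable A -> A `<=` `]0, +oo[ ->
        phi A = (\int[lebesgue_measure]_(t in A) (f t)%:E)%E].

(* Weak scaling conditions, at zero (L_1, U_1) and at infinity (L^1, U^1). *)
Definition lower_scaling0 b g : Prop :=
  exists2 c : R, 0 < c <= 1 &
    forall r s : R, 0 < r -> r <= s -> s < 1 -> c * (s / r) `^ b <= g s / g r.

Definition upper_scaling0 b g : Prop :=
  exists2 C : R, 1 <= C &
    forall r s : R, 0 < r -> r <= s -> s < 1 -> g s / g r <= C * (s / r) `^ b.

Definition lower_scaling_oo b g : Prop :=
  exists2 c : R, 0 < c <= 1 &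
    forall r s : R, 1 <= r -> r <= s -> c * (s / r) `^ b <= g s / g r.

Definition upper_scaling_oo b g : Prop :=
  exists2 C : R, 1 <= C &
    forall r s : R, 1 <= r -> r <= s -> g s / g r <= C * (s / r) `^ b.

(* F and G are comparable on the range D, with a constant k uniform in D. *)
Definition comparable_on (D : R -> R -> Prop) (F G : R -> R -> \bar R) : Prop :=
  exists2 k : R, 0 < k &
    forall x y, D x y ->
      (k^-1%:E * G x y <= F x y)%E /\ (F x y <= k%:E * G x y)%E.

End Definitions.

(* Main.v *)
Require Import Defs.
From HB Require Import structures.
From mathcomp Require Import all_boot all_order all_algebra.
From mathcomp Require Import all_classical all_reals all_analysis.
From mathcomp Require Import measurable_realfun.
From mathcomp Require Import lra ring.

Set Implicit Arguments.
Unset Strict Implicit.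
Unset Printing Implicit Defensive.

Import Order.TTheory GRing.Theory Num.Theory.
Import numFieldNormedType.Exports.

Local Open Scope classical_set_scope.
Local Open Scope ring_scope.

(** Write p = 1 + alpha. Since (x + y / t)^(-p) / t = t^alpha (x t + y)^(-p),
    the density q(x, y) is c_- times the integral of
    t^alpha (x t + y)^(-p) f(t) over t > 0. The constant c_- is a positive real
    because alpha (1 - rho) lies in ]0, 1[ for a permissible pair and Euler's
    integral converges at positive arguments ([c_minus_gt0]). It remains to
    study S(s), the integral of t^alpha (t + s)^(-p) f(t): by [q_cmp],
    q(X, Y) is comparable to z^(-p) S(s) as soon as X is comparable to z and
    Y to z s. Three choices are made.

    If x <= y <= 5 x, take z = x and s = 1: both q(x, y) and q(y, x) are
    comparable to x^(-p) S(1), and 0 < S(1) < +oo because f is positive with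
    integral at most 1.

    If 5 x <= y, then q(y, x) is comparable to (y - x)^(-p) S(s) at
    s = x / (y - x) <= 1 / 4, and q(x, y) to x^(-p) S(T) at
    T = (y - x) / x >= 4. As t + s lies between max(t, s) and 2 max(t, s),
    S(s) is comparable to the sum of s^(-p) times the moment, the integral of
    t^alpha f over ]0, s], and of the tail, the integral of f(t) / t over
    ]s, +oo[. The scaling conditions say which term wins.

    Near zero, lower scaling with exponent > -p bounds the moment by
    s^p f(s), and bounds the tail from below by f(s), using [s, 2 s] only; so
    the tail wins ([stieltjes_cmp_tail]), and the part of it beyond 1 is a
    constant that the rest absorbs. A negative upper exponent conversely
    bounds the tail by f(s) ([tail_cmp_density]).

    Near infinity the roles are exchanged. A negative upper exponent bounds
    the tail by f(T), and bounds the moment from below by T^p f(T), using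
    [T / 2, T] only; so the moment wins ([stieltjes_cmp_moment]). Lower
    scaling with exponent > -p conversely bounds the moment by T^p f(T)
    ([moment_cmp_density]). *)

(** * Integrals over the positive half-line, Gamma *)

Section PositiveHalfLine.
Variable R : realType.
Implicit Types (a b s t k : R) (g h : R -> R) (D : set R).

Notation mu := (@lebesgue_measure R).
Notation pos := (`]0, +oo[%classic : set R).

Lemma in_pos t : pos t = (0 < t) :> Prop.
Proof. by rewrite /= in_itv/= andbT. Qed.

Lemma measurable_pos_sub D g : D `<=` pos ->
  measurable_fun pos g -> measurable_fun D g.
Proof. by move=> DP; apply: measurable_funS. Qed.

Lemma measurable_pos_id : measurable_fun pos (fun t => t).
Proof. exact: measurable_id. Qed.

Lemma measurable_pos_powR g a : measurable_fun pos g ->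
  measurable_fun pos (fun t => g t `^ a).
Proof. by move=> mg; exact: (measurableT_comp (measurable_powR a) mg). Qed.

Lemma measurable_pos_inv g : (forall t, 0 < t -> 0 <= g t) ->
  measurable_fun pos g ->
  measurable_fun pos (fun t => (g t)^-1).
Proof.
move=> g0 mg; apply: (eq_measurable_fun (fun t => g t `^ (-1))).
  by move=> t; rewrite inE in_pos => /g0 t0; rewrite powR_inv1.
exact: measurable_pos_powR.
Qed.

Lemma measurable_pos_mul g h : measurable_fun pos g -> measurable_fun pos h ->
  measurable_fun pos (fun t => g t * h t).
Proof. exact: measurable_funM. Qed.

Lemma measurable_pos_add g h : measurable_fun pos g -> measurable_fun pos h ->
  measurable_fun pos (fun t => g t + h t).
Proof. exact: measurable_funD. Qed.

Lemma int_le D g h : measurable D -> D `<=` pos ->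
  measurable_fun pos g -> measurable_fun pos h ->
  (forall t, D t -> 0 <= g t <= h t) ->
  (\int[mu]_(t in D) (g t)%:E <= \int[mu]_(t in D) (h t)%:E)%E.
Proof.
move=> mD DP mg mh gh; apply: ge0_le_integral => //.
- by move=> t /gh /andP[]; rewrite lee_fin.
- by apply/measurable_EFinP; exact: measurable_pos_sub mg.
- by apply/measurable_EFinP; exact: measurable_pos_sub mh.
- by move=> t /gh /andP[]; rewrite lee_fin.
Qed.

Lemma int_ge0 D g : (forall t, D t -> 0 <= g t) ->
  (0 <= \int[mu]_(t in D) (g t)%:E)%E.
Proof. by move=> g0; apply: integral_ge0 => t Dt; rewrite lee_fin g0. Qed.

Lemma intZ D g k : measurable D -> D `<=` pos -> measurable_fun pos g ->
  (forall t, D t -> 0 <= g t) -> 0 <= k ->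
  (\int[mu]_(t in D) (k * g t)%:E = k%:E * \int[mu]_(t in D) (g t)%:E)%E.
Proof.
move=> mD DP mg g0 k0; under eq_integral do rewrite EFinM.
rewrite ge0_integralZl_EFin//.
by apply/measurable_EFinP; exact: measurable_pos_sub mg.
Qed.

Lemma int_leZ D g h k : measurable D -> D `<=` pos ->
  measurable_fun pos g -> measurable_fun pos h -> 0 <= k ->
  (forall t, D t -> 0 <= h t) -> (forall t, D t -> 0 <= g t <= k * h t) ->
  (\int[mu]_(t in D) (g t)%:E <= k%:E * \int[mu]_(t in D) (h t)%:E)%E.
Proof.
move=> mD DP mg mh k0 h0 gh; rewrite -intZ//; apply: int_le => //.
exact: measurable_pos_mul.
Qed.

Lemma int_geZ D g h k : measurable D -> D `<=` pos ->
  measurable_fun pos g -> measurable_fun pos h -> 0 <= k ->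
  (forall t, D t -> 0 <= h t) -> (forall t, D t -> k * h t <= g t) ->
  (k%:E * \int[mu]_(t in D) (h t)%:E <= \int[mu]_(t in D) (g t)%:E)%E.
Proof.
move=> mD DP mg mh k0 h0 gh; rewrite -intZ//; apply: int_le => //.
  exact: measurable_pos_mul.
by move=> t Dt; rewrite gh// mulr_ge0// h0.
Qed.

Lemma int_sub D E g : measurable D -> measurable E -> E `<=` pos ->
  measurable_fun pos g -> (forall t, 0 < t -> 0 <= g t) -> D `<=` E ->
  (\int[mu]_(t in D) (g t)%:E <= \int[mu]_(t in E) (g t)%:E)%E.
Proof.
move=> mD mE EP mg g0 DE; apply: ge0_subset_integral => //.
  by apply/measurable_EFinP; exact: measurable_pos_sub mg.
by move=> t /EP; rewrite in_pos lee_fin; exact: g0.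
Qed.

Lemma int_setU_le D E g : measurable D -> measurable E -> D `|` E `<=` pos ->
  measurable_fun pos g -> (forall t, 0 < t -> 0 <= g t) ->
  (\int[mu]_(t in D `|` E) (g t)%:E <=
   \int[mu]_(t in D) (g t)%:E + \int[mu]_(t in E) (g t)%:E)%E.
Proof.
move=> mD mE DEP mg g0; rewrite -(setDUK (@subsetUl _ D E)).
rewrite ge0_integral_setU//.
- apply: leeD => //; apply: int_sub => //.
  + by apply: measurableD => //; exact: measurableU.
  + by apply: subset_trans DEP; exact: subsetUr.
  + by rewrite setDUl setDv set0U; exact: subDsetl.
- by apply: measurableD => //; exact: measurableU.
- apply/measurable_EFinP; apply: measurable_pos_sub mg.
  by rewrite setDUK//; exact: subsetUl.
- move=> t; rewrite setDUK; last exact: subsetUl.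
  by move=> /DEP; rewrite in_pos lee_fin => /g0.
- by apply/disj_setPS => t [Dt [_ /(_ Dt)]].
Qed.

(** A nonnegative function on ]0, +oo[ may be integrated by exhausting its
    domain with compact intervals, on which the singularities at 0 and at
    infinity are absent. *)
Lemma int_exhaust D g (M : \bar R) : measurable D -> D `<=` pos ->
  measurable_fun pos g -> (forall t, 0 < t -> 0 <= g t) ->
  (forall a b, 0 < a -> a < b ->
     (\int[mu]_(t in D `&` `[a, b]) (g t)%:E <= M)%E) ->
  (\int[mu]_(t in D) (g t)%:E <= M)%E.
Proof.
move=> mD DP mg g0 gM.
pose F n := D `&` `[n.+2%:R^-1 : R, n.+2%:R].
have FP n : F n `<=` pos by move=> t [/DP].
have DE : \bigcup_n F n = D.
  apply/seteqP; split=> [t [n _ []]//|t Dt].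
  have := DP _ Dt; rewrite in_pos => t0.
  pose m := maxn (Num.truncn t) (Num.truncn t^-1).
  exists m => //; split=> //; rewrite /= in_itv/=; apply/andP; split.
    rewrite invf_ple ?posrE//; apply: (le_trans (ltW (truncnS_gt _))).
    by rewrite ler_nat /m ltnS leqW ?leq_maxr.
  apply: (le_trans (ltW (truncnS_gt _))).
  by rewrite ler_nat /m ltnS leqW ?leq_maxl.
have mF n : measurable (F n) by apply: measurableI.
have cvgF : (\int[mu]_(t in F n) (g t)%:E)%E @[n --> \oo] -->
    (\int[mu]_(t in \bigcup_n F n) (g t)%:E)%E.
  apply: ge0_nondecreasing_set_cvg_integral => //.
  - move=> m n mn; apply/subsetPset; apply: setIS => t /=.
    rewrite !in_itv/= => /andP[mt tm]; apply/andP; split.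
      by apply: le_trans mt; rewrite lef_pV2 ?posrE// ler_nat !ltnS.
    by apply: (le_trans tm); rewrite ler_nat !ltnS.
  - by move=> n; apply/measurable_EFinP; apply: measurable_pos_sub mg.
  - by move=> n t /FP; rewrite in_pos lee_fin; exact: g0.
rewrite -{}DE -(cvg_lim _ cvgF)//.
apply: lime_le; first by apply/cvg_ex; eexists; exact: cvgF.
apply: nearW => n; apply: gM; first by rewrite invr_gt0.
by rewrite (@lt_trans _ _ 1)// ?ltr1n// invf_lt1// ltr1n.
Qed.

Lemma int_powR_itv a s t : a != -1 -> 0 < s -> s < t ->
  (\int[mu]_(u in `[s, t]) (u `^ a)%:E =
   ((t `^ (a + 1) - s `^ (a + 1)) / (a + 1))%:E)%E.
Proof.
move=> a1 s0 st.
have a10 : a + 1 != 0 by rewrite addr_eq0.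
pose F u := (a + 1)^-1 * u `^ (a + 1).
have dF (u : R) : 0 < u -> is_derive u (1 : R) F (u `^ a).
  move=> u0; have -> : u `^ a = (a + 1)^-1 *: ((a + 1) * u `^ (a + 1 - 1)).
    by rewrite addrK scalerA mulVf// scale1r.
  have := is_derive1_powR (a + 1) u0; move=> H.
  exact: is_deriveZ.
rewrite (@continuous_FTC2 _ _ F)//.
- by rewrite -EFinB /F -mulrBr mulrC.
- apply: derivable_within_continuous => u; rewrite in_itv/= => /andP[su _].
  by apply: derivable_powR; rewrite in_itv/= andbT (lt_le_trans s0).
- have cF : {within `[s, t], continuous F}.
    apply: derivable_within_continuous => u; rewrite in_itv/= => /andP[su _].
    by have [] := dF u (lt_le_trans s0 su).
  have [_ Fs Ft] := (continuous_within_itvP F st).1 cF.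
  split => // u; rewrite in_itv/= => /andP[su _].
  by have [] := dF u (lt_trans s0 su).
- move=> u; rewrite in_itv/= => /andP[su _]; rewrite derive1E.
  by have [_ ->] := dF u (lt_trans s0 su).
Qed.

(** For D = ]0, s] this is an equality; a bound on an arbitrary D lets a
    scaling condition be used on the part of ]0, s] where it is available. *)
Lemma int_powR_near0 a s D : -1 < a -> 0 < s -> measurable D ->
  D `<=` `]0, s] ->
  (\int[mu]_(t in D) (t `^ a)%:E <= (s `^ (a + 1) / (a + 1))%:E)%E.
Proof.
move=> a1 s0 mD Ds.
have a10 : 0 < a + 1 by rewrite -ltrBlDr sub0r.
have DP : D `<=` pos by move=> t /Ds; rewrite /= !in_itv/= andbT => /andP[].
have mp : measurable_fun pos (fun t => t `^ a).
  exact: measurable_pos_powR measurable_pos_id.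
have p0 t : 0 < t -> 0 <= t `^ a by rewrite powR_ge0.
apply: int_exhaust => // u v u0 uv.
have [us|su] := ltP u s; last first.
  apply: (@le_trans _ _ (\int[mu]_(t in [set s]) (t `^ a)%:E)%E).
    apply: int_sub => //; first exact: measurableI.
      by move=> _ -> /=; rewrite in_itv/= andbT.
    move=> t [/Ds] /=; rewrite !in_itv/= => /andP[_ ts] /andP[ut _].
    by apply/eqP; rewrite eq_le ts (le_trans su).
  by rewrite integral_set1 lee_fin divr_ge0 ?powR_ge0// ltW.
apply: (@le_trans _ _ (\int[mu]_(t in `[u, s]) (t `^ a)%:E)%E).
  apply: int_sub => //; first exact: measurableI.
    by move=> t; rewrite /= !in_itv/= andbT => /andP[+ _]; exact: lt_le_trans.
  by move=> t [/Ds] /=; rewrite !in_itv/= => /andP[_ ->] /andP[-> _].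
rewrite int_powR_itv ?(gt_eqF a1)//.
by rewrite lee_fin ler_pM2r ?invr_gt0// gerBl powR_ge0.
Qed.

Lemma int_powR_tail a s D : a < -1 -> 0 < s -> measurable D ->
  D `<=` `[s, +oo[ ->
  (\int[mu]_(t in D) (t `^ a)%:E <= (s `^ (a + 1) / - (a + 1))%:E)%E.
Proof.
move=> a1 s0 mD Ds.
have a10 : 0 < - (a + 1) by rewrite oppr_gt0 -ltrBrDr sub0r.
have DP : D `<=` pos.
  by move=> t /Ds; rewrite /= !in_itv/= !andbT; exact: lt_le_trans.
have mp : measurable_fun pos (fun t => t `^ a).
  exact: measurable_pos_powR measurable_pos_id.
have p0 t : 0 < t -> 0 <= t `^ a by rewrite powR_ge0.
apply: int_exhaust => // u v u0 uv.
have [sv|vs] := ltP s v; last first.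
  apply: (@le_trans _ _ (\int[mu]_(t in [set s]) (t `^ a)%:E)%E).
    apply: int_sub => //; first exact: measurableI.
      by move=> _ -> /=; rewrite in_itv/= andbT.
    move=> t [/Ds] /=; rewrite !in_itv/= !andbT => st /andP[_ tv].
    by apply/eqP; rewrite eq_le st (le_trans tv).
  by rewrite integral_set1 lee_fin divr_ge0 ?powR_ge0// ltW.
apply: (@le_trans _ _ (\int[mu]_(t in `[s, v]) (t `^ a)%:E)%E).
  apply: int_sub => //; first exact: measurableI.
    by move=> t; rewrite /= !in_itv/= andbT => /andP[+ _]; exact: lt_le_trans.
  by move=> t [/Ds] /=; rewrite !in_itv/= andbT => -> /andP[_ ->].
rewrite int_powR_itv ?(lt_eqF a1)//.
rewrite lee_fin -[leLHS]mulrNN -invrN opprB ler_pM2r ?invr_gt0//.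
by rewrite gerBl powR_ge0.
Qed.

Lemma int_gt0 D g : measurable D -> D `<=` pos -> measurable_fun pos g ->
  (forall t, 0 < t -> 0 < g t) -> (0 < mu D)%E ->
  (0 < \int[mu]_(t in D) (g t)%:E)%E.
Proof.
move=> mD DP mg g0 D0.
have mgE : measurable_fun D (EFin \o g).
  by apply/measurable_EFinP; exact: measurable_pos_sub mg.
rewrite lt0e int_ge0 ?andbT; last by move=> t /DP; rewrite in_pos => /g0/ltW.
apply/eqP => I0; have [aeg _] := ae_eq_integral_abs mu mD mgE.
have : ae_eq mu D (EFin \o g) (cst 0%E).
  apply: aeg; rewrite -[RHS]I0; apply: eq_integral => t; rewrite inE => Dt.
  by rewrite /= ger0_norm//; have := DP _ Dt; rewrite in_pos => /g0/ltW.
move=> [N [mN N0 DN]].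
suff : (mu D <= mu N)%E by rewrite N0 leNgt D0.
apply: le_measure; rewrite ?inE// => t Dt; apply: DN => /= /(_ Dt) [gt0].
by have := DP _ Dt; rewrite in_pos => /g0; rewrite gt0 ltxx.
Qed.

(** [Gamma] is a real-valued integral, hence would be 0 if the integral
    diverged: its positivity contains the convergence of Euler's integral. *)
Lemma Gamma_gt0 s : 0 < s -> 0 < Gamma s.
Proof.
move=> s0; rewrite /Gamma /Rintegral.
pose g t := t `^ (s - 1) * expR (- t).
have mg : measurable_fun pos g.
  apply: measurable_pos_mul; first exact: measurable_pos_powR measurable_pos_id.
  apply: (measurableT_comp (@measurable_expR R)).
  exact: (measurableT_comp (@oppr_measurable R _) measurable_pos_id).
have g0 t : 0 < t -> 0 < g t by move=> t0; rewrite mulr_gt0 ?powR_gt0 ?expR_gt0.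
have g0' t : 0 < t -> 0 <= g t by move/g0/ltW.
apply: fine_gt0; apply/andP; split.
  apply: int_gt0 => //.
  by rewrite lebesgue_measure_itv/= ltry addye ?ltry.
have sub01 : `]0, 1]%classic `<=` pos.
  by move=> t; rewrite /= !in_itv/= => /andP[->].
have sub1y : `[1, +oo[%classic `<=` pos.
  by move=> t; rewrite /= !in_itv/= !andbT; exact: lt_le_trans.
have -> : pos = `]0, 1] `|` `[1, +oo[.
  apply/seteqP; split=> t /=; rewrite !in_itv/= !andbT.
    by move=> t0; have [t1|t1] := leP t 1; [left; rewrite t0|right; exact: ltW].
  by move=> [/andP[]//|]; exact: lt_le_trans.
apply: le_lt_trans (int_setU_le _ _ _ mg g0') _ => //.
  by move=> t [/sub01|/sub1y].
apply: lte_add_pinfty.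
  apply: (@le_lt_trans _ _ (\int[mu]_(t in `]0%R, 1%R]) (t `^ (s - 1))%:E)%E).
    apply: int_le => //; first exact: measurable_pos_powR measurable_pos_id.
    move=> t /sub01; rewrite in_pos => t0; rewrite g0'//=.
    by rewrite ler_piMr ?powR_ge0// -expR0 ler_expR oppr_le0 ltW.
  apply: (le_lt_trans (@int_powR_near0 _ 1 _ _ _ _ _)) => //.
    by rewrite ltrBrDl subrr.
  exact: ltry.
(* On [1, +oo[ the integrand is at most C / t ^ 2: the constant C comes from
   ln u <= u - 1 at u = t / (s + 1). *)
pose C := expR ((s + 1) * ln (s + 1)).
have s1 : 0 < s + 1 by rewrite addr_gt0.
have expC t : 0 < t -> expR (- t) <= C * t `^ (- s - 1).
  move=> t0; rewrite /powR gt_eqF// /C -expRD ler_expR.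
  have : ln (1 + (t / (s + 1) - 1)) <= t / (s + 1) - 1.
    by apply: le_ln1Dx; rewrite ltrBrDl subrr divr_gt0.
  rewrite addrC subrK ln_div ?posrE// => H.
  have := ler_wpM2l (ltW s1) H; rewrite !mulrBr mulrCA divff ?gt_eqF// !mulr1.
  move=> H'; nra.
apply: (@le_lt_trans _ _ (C%:E * \int[mu]_(t in `[1%R, +oo[) (t `^ (-2))%:E)%E).
  apply: int_leZ => //; first exact: measurable_pos_powR measurable_pos_id.
  - exact: expR_ge0.
  - by move=> t _; exact: powR_ge0.
  - move=> t /sub1y; rewrite in_pos => t0; rewrite g0'//=.
    rewrite (le_trans (ler_wpM2l (powR_ge0 _ _) (expC _ t0)))//.
    rewrite mulrCA ler_wpM2l ?expR_ge0// -powRD; last first.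
      by apply/implyP => _; rewrite gt_eqF.
    by have -> : s - 1 + (- s - 1) = -2 :> R by ring.
have N21 : (-2 : R) < -1 by lra.
rewrite lte_mul_pinfty ?lee_fin ?expR_ge0//.
by apply: (le_lt_trans (@int_powR_tail _ 1 _ N21 _ _ _)) => //; exact: ltry.
Qed.

Lemma c_minus_gt0 (alpha rho : R) :
  permissible alpha rho -> 0 < c_minus alpha rho.
Proof.
move=> perm; suff [a0 r0] : 0 < alpha /\ 0 < alpha * (1 - rho) < 1.
  move/andP : r0 => [r0 r1].
  by rewrite divr_gt0// ?mulr_gt0// ?Gamma_gt0// ?subr_gt0// addr_gt0.
case: perm => [[/andP[a0 a1] /andP[r0 r1]]|[/andP[a1 _] /andP[r0 r1]]|[-> ->]].
- split => //; nra.
- have a0 : 0 < alpha by exact: lt_trans a1.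
  split => //; have : alpha * alpha^-1 = 1 by rewrite divff ?gt_eqF.
  move: (alpha^-1) r0 r1 => b r0 r1 ab; nra.
- split => //; lra.
Qed.

End PositiveHalfLine.

(** * Integration against a measure with a density *)

Section Density.
Context d (T : measurableType d) (R : realType).
Local Open Scope ereal_scope.

Import HBNNSimple.

(** The density is prescribed for subsets of D only, so that nu may have a
    singular part, such as an atom, outside D. *)
Lemma integral_density (nu mu : {measure set T -> \bar R}) (D : set T)
    (f : T -> R) (g : T -> \bar R) :
  measurable D -> measurable_fun D f -> (forall t, D t -> (0 <= f t)%R) ->
  (forall A, measurable A -> A `<=` D -> nu A = \int[mu]_(t in A) (f t)%:E) ->
  measurable_fun D g -> (forall t, D t -> 0 <= g t) ->
  \int[nu]_(t in D) g t = \int[mu]_(t in D) (g t * (f t)%:E).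
Proof.
move=> mD mf f0 nuE mg g0.
have mfE : measurable_fun D (EFin \o f) by exact/measurable_EFinP.
pose h := nnsfun_approx mD mg.
have mh n : measurable_fun D (EFin \o h n).
  by apply/measurable_EFinP; apply: measurable_funTS; exact/measurable_funP.
have -> : \int[nu]_(t in D) g t =
    limn (fun n => \int[nu]_(t in D) (EFin \o h n) t).
  rewrite -monotone_convergence//.
  - apply: eq_integral => t /[!inE] Dt; apply/esym/cvg_lim => //.
    exact: cvg_nnsfun_approx.
  - by move=> n t Dt /=; rewrite lee_fin.
  - by move=> t Dt a b ab; rewrite lee_fin; exact/lefP/nd_nnsfun_approx.
have -> : \int[mu]_(t in D) (g t * (f t)%:E) =
    limn (fun n => \int[mu]_(t in D) ((EFin \o h n) t * (f t)%:E)).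
  rewrite -monotone_convergence//.
  - apply: eq_integral => t /[!inE] Dt; apply/esym/cvg_lim => //.
    by apply: cvgeZr => //; exact: cvg_nnsfun_approx.
  - by move=> n; exact: emeasurable_funM.
  - by move=> n t Dt /=; rewrite mule_ge0 ?lee_fin ?f0.
  - move=> t Dt a b ab; rewrite lee_wpmul2r ?lee_fin ?f0//.
    exact/lefP/nd_nnsfun_approx.
suff suf n : \int[nu]_(t in D) (EFin \o h n) t =
    \int[mu]_(t in D) ((EFin \o h n) t * (f t)%:E).
  by congr (limn _); apply/funext => n.
transitivity (\int[nu]_(t in D) (\sum_(y \in range (h n))
    (y * \1_(h n @^-1` [set y]) t)%:E)).
  by apply: eq_integral => t tD; rewrite /= fimfunE -fsumEFin.
have mi y : measurable_fun D (fun t => (y * \1_(h n @^-1` [set y]) t)%:E).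
  by apply: (measurable_comp measurableT) => //; exact: measurable_funM.
rewrite ge0_integral_fsum//; last by move=> y t Dt; exact: nnfun_muleindic_ge0.
transitivity (\int[mu]_(t in D) (\sum_(y \in range (h n))
    (y * \1_(h n @^-1` [set y]) t)%:E * (f t)%:E)); last first.
  apply: eq_integral => t tD.
  rewrite -ge0_mule_fsuml => [|y]; last exact: nnfun_muleindic_ge0.
  by rewrite fsumEFin // -(fimfunE _ t).
rewrite [RHS]ge0_integral_fsum//; last 2 first.
  - by move=> y; exact: emeasurable_funM.
  - move=> y t Dt; rewrite mule_ge0 ?lee_fin ?f0//.
    by have := nnfun_muleindic_ge0 (h n) y t; rewrite lee_fin.
apply: eq_fsbigr => y /[!inE] -[t0 _ yE].
have y0 : (0 <= y)%R by rewrite -yE.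
have mH : measurable (h n @^-1` [set y]) by [].
under eq_integral do rewrite EFinM.
rewrite ge0_integralZl_EFin//; last first.
  by apply/measurable_EFinP; exact: measurable_indic.
under [RHS]eq_integral do rewrite EFinM -muleA.
rewrite ge0_integralZl_EFin//; last 2 first.
  - by move=> t Dt; rewrite mule_ge0 ?lee_fin ?f0.
  - by apply: emeasurable_funM => //; apply/measurable_EFinP.
congr (_ * _); rewrite integral_indic//.
under eq_integral do rewrite muleC.
rewrite (eq_integral ((EFin \o f) \_ (h n @^-1` [set y]))); last first.
  by move=> t tD; rewrite epatch_indic.
rewrite -integral_mkcondr setIC; apply: nuE; first exact: measurableI.
exact: subIsetl.
Qed.

End Density.

(** * Calculus of comparability *)

Section Comparability.
Variable R : realType.
Implicit Types (D E : R -> R -> Prop) (F G H : R -> R -> \bar R)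
  (u v : R -> R -> R).

Lemma lee_pmul_inv (k : R) (a b : \bar R) : 0 < k ->
  (k^-1%:E * a <= b)%E = (a <= k%:E * b)%E.
Proof.
move=> k0; rewrite -(@lee_pmul2l _ k%:E)// ?lte_fin//.
by rewrite muleA -EFinM divff ?gt_eqF// mul1e.
Qed.

(** Two one-sided bounds with different constants; nonnegativity is what
    allows both constants to be replaced by a larger one. *)
Lemma cmp_intro D F G (k l : R) : 0 <= k -> 0 <= l ->
  (forall x y, D x y -> (0 <= F x y)%E) ->
  (forall x y, D x y -> (0 <= G x y)%E) ->
  (forall x y, D x y -> (F x y <= k%:E * G x y)%E) ->
  (forall x y, D x y -> (G x y <= l%:E * F x y)%E) -> comparable_on D F G.
Proof.
move=> k0 l0 F0 G0 FG GF.
have m0 : 0 < 1 + k + l by rewrite -addrA ltr_pwDl// addr_ge0.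
exists (1 + k + l) => // x y Dxy; split.
  rewrite lee_pmul_inv//; apply: le_trans (GF _ _ Dxy) _.
  by rewrite lee_wpmul2r ?F0// lee_fin lerDr addr_ge0.
apply: le_trans (FG _ _ Dxy) _.
by rewrite lee_wpmul2r ?G0// lee_fin addrAC lerDr addr_ge0.
Qed.

Lemma cmp_eq D F G : (forall x y, D x y -> F x y = G x y) ->
  comparable_on D F G.
Proof.
by move=> FG; exists 1 => // x y Dxy; rewrite FG// invr1 mul1e.
Qed.

Lemma cmp_sym D F G : comparable_on D F G -> comparable_on D G F.
Proof.
move=> [k k0 kFG]; exists k => // x y /kFG[GF FG].
by split; [rewrite lee_pmul_inv|rewrite -lee_pmul_inv].
Qed.

Lemma cmp_trans D F G H :
  comparable_on D F G -> comparable_on D G H -> comparable_on D F H.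
Proof.
move=> [k k0 kFG] [l l0 lGH]; exists (k * l); first exact: mulr_gt0.
move=> x y Dxy; have [GF FG] := kFG _ _ Dxy; have [HG GH] := lGH _ _ Dxy.
split.
  rewrite lee_pmul_inv ?mulr_gt0// mulrC EFinM -muleA -lee_pmul_inv//.
  by rewrite (le_trans HG)// -lee_pmul_inv.
by rewrite (le_trans FG)// EFinM -muleA lee_pmul2l// lte_fin.
Qed.

Lemma cmp_comp D E F G u v : (forall x y, E x y -> D (u x y) (v x y)) ->
  comparable_on D F G ->
  comparable_on E (fun x y => F (u x y) (v x y)) (fun x y => G (u x y) (v x y)).
Proof. by move=> ED [k k0 kFG]; exists k => // x y /ED/kFG. Qed.

Lemma cmp_mul D u v F G :
  (forall x y, D x y -> 0 <= u x y) -> (forall x y, D x y -> 0 <= v x y) ->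
  (forall x y, D x y -> (0 <= F x y)%E) ->
  (forall x y, D x y -> (0 <= G x y)%E) ->
  comparable_on D (fun x y => (u x y)%:E) (fun x y => (v x y)%:E) ->
  comparable_on D F G ->
  comparable_on D (fun x y => (u x y)%:E * F x y)%E
                  (fun x y => (v x y)%:E * G x y)%E.
Proof.
move=> u0 v0 F0 G0 [k k0 kuv] [l l0 lFG].
exists (k * l); first exact: mulr_gt0.
move=> x y Dxy; have [vu uv] := kuv _ _ Dxy; have [GF FG] := lFG _ _ Dxy.
split.
  rewrite invfM EFinM muleACA; apply: lee_pmul => //.
    by rewrite -EFinM lee_fin mulr_ge0 ?v0 ?invr_ge0 ?ltW.
  by rewrite mule_ge0 ?G0// lee_fin invr_ge0 ltW.
by rewrite EFinM muleACA; apply: lee_pmul; rewrite ?lee_fin ?u0 ?F0.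
Qed.

Lemma cmp_mull D u F G :
  (forall x y, D x y -> 0 <= u x y) ->
  (forall x y, D x y -> (0 <= F x y)%E) ->
  (forall x y, D x y -> (0 <= G x y)%E) ->
  comparable_on D F G ->
  comparable_on D (fun x y => (u x y)%:E * F x y)%E
                  (fun x y => (u x y)%:E * G x y)%E.
Proof. by move=> u0 F0 G0; apply: cmp_mul => //; exact: cmp_eq. Qed.

(** The absolute value covers exponents of either sign: |ln (u / v)| <= ln k
    gives |a ln (u / v)| <= |a| ln k. *)
Lemma powR_cmp (k u v a : R) : 0 < k -> 0 < u -> 0 < v ->
  k^-1 * v <= u -> u <= k * v ->
  (k `^ `|a|)^-1 * v `^ a <= u `^ a /\ u `^ a <= k `^ `|a| * v `^ a.
Proof.
move=> k0 u0 v0 vu uv.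
have lvu : ln v - ln k <= ln u.
  rewrite -ln_div ?posrE// ler_ln ?posrE ?divr_gt0//.
  by rewrite mulrC.
have luv : ln u <= ln k + ln v.
  by rewrite -lnM ?posrE// ler_ln ?posrE ?mulr_gt0.
have H : `|a * (ln u - ln v)| <= `|a| * ln k.
  rewrite normrM ler_wpM2l// ler_norml; apply/andP; split; lra.
move: H; rewrite ler_norml => /andP[H1 H2].
rewrite -powRN /powR !gt_eqF// -!expRD !ler_expR.
split; nra.
Qed.

Lemma cmp_powR D u v (a : R) :
  (forall x y, D x y -> 0 < u x y) -> (forall x y, D x y -> 0 < v x y) ->
  comparable_on D (fun x y => (u x y)%:E) (fun x y => (v x y)%:E) ->
  comparable_on D (fun x y => (u x y `^ a)%:E) (fun x y => (v x y `^ a)%:E).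
Proof.
move=> u0 v0 [k k0 kuv]; exists (k `^ `|a|); first exact: powR_gt0.
move=> x y Dxy; have := kuv _ _ Dxy; rewrite -!EFinM !lee_fin => -[vu uv].
exact: powR_cmp (u0 _ _ Dxy) (v0 _ _ Dxy) vu uv.
Qed.

End Comparability.

(** * Moments and tails of the density *)

Section WeightedIntegrals.
Variables (R : realType) (alpha : R) (f : R -> R).
Implicit Types (s t a b c C k : R) (D : set R).

Notation mu := (@lebesgue_measure R).
Notation pos := (`]0, +oo[%classic : set R).

Hypothesis alpha0 : 0 < alpha.
Hypothesis mf : measurable_fun pos f.
Hypothesis f0 : forall t, 0 < t -> 0 < f t.

Let f0' t : 0 < t -> 0 <= f t. Proof. by move/f0/ltW. Qed.

Let mA : measurable_fun pos (fun t => t `^ alpha * f t).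
Proof.
apply: measurable_pos_mul => //.
exact: measurable_pos_powR (@measurable_pos_id R).
Qed.

Let mB : measurable_fun pos (fun t => f t / t).
Proof.
apply: measurable_pos_mul => //.
by apply: measurable_pos_inv; [move=> t /ltW|exact: measurable_pos_id].
Qed.

Let A0 t : 0 < t -> 0 < t `^ alpha * f t.
Proof. by move=> t0; rewrite mulr_gt0 ?powR_gt0 ?f0. Qed.

Let B0 t : 0 < t -> 0 < f t / t.
Proof. by move=> t0; rewrite divr_gt0 ?f0. Qed.

Let A0' t : 0 < t -> 0 <= t `^ alpha * f t. Proof. by move/A0/ltW. Qed.
Let B0' t : 0 < t -> 0 <= f t / t. Proof. by move/B0/ltW. Qed.

(** As b > -1 - alpha, the integrand is dominated by a power that is integrable
    at 0, and the integral is governed by its upper end: up to a constant it is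
    at most its value for f constant, equal to f s, on ]0, s]. *)
Lemma int_moment_le D s b C : measurable D -> D `<=` `]0, s] -> 0 < s ->
  - 1 - alpha < b -> 0 <= C ->
  (forall t, D t -> f t <= C * (t / s) `^ b * f s) ->
  (\int[mu]_(t in D) (t `^ alpha * f t)%:E <=
   (C / (alpha + b + 1) * (s `^ (1 + alpha) * f s))%:E)%E.
Proof.
move=> mD Ds s0 b1 C0 fC.
have DP : D `<=` pos by move=> t /Ds; rewrite /= !in_itv/= andbT => /andP[].
have ab : -1 < alpha + b by lra.
have ab1 : 0 < alpha + b + 1 by lra.
apply: (@le_trans _ _ ((C * s `^ (- b) * f s)%:E *
    \int[mu]_(t in D) (t `^ (alpha + b))%:E)%E).
  apply: int_leZ => //; first exact: measurable_pos_powR (@measurable_pos_id R).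
  - by rewrite !mulr_ge0 ?powR_ge0 ?f0'.
  - by move=> t _; exact: powR_ge0.
  - move=> t Dt; have := DP _ Dt; rewrite in_pos => t0; rewrite A0'//=.
    apply: (le_trans (ler_wpM2l (powR_ge0 t alpha) (fC _ Dt))).
    rewrite powRM ?invr_ge0 ?(ltW t0) ?(ltW s0)//.
    rewrite -(powR_inv1 (ltW s0)) -powRrM mulN1r.
    rewrite powRD; last by apply/implyP => _; rewrite gt_eqF.
    by rewrite le_eqVlt; apply/orP; left; apply/eqP; ring.
apply: (@le_trans _ _ ((C * s `^ (- b) * f s)%:E *
    (s `^ (alpha + b + 1) / (alpha + b + 1))%:E)%E).
  rewrite lee_wpmul2l ?lee_fin ?mulr_ge0 ?powR_ge0 ?f0'//.
  exact: int_powR_near0.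
rewrite -EFinM lee_fin le_eqVlt; apply/orP; left; apply/eqP.
have -> : 1 + alpha = - b + (alpha + b + 1) by ring.
rewrite (@powRD _ s (- b)); last by apply/implyP => _; rewrite gt_eqF.
by ring.
Qed.

(** Symmetrically, for b < 0 the integral is governed by its lower end. *)
Lemma int_tail_le D s b C : measurable D -> D `<=` `[s, +oo[ -> 0 < s ->
  b < 0 -> 0 <= C ->
  (forall t, D t -> f t <= C * (t / s) `^ b * f s) ->
  (\int[mu]_(t in D) (f t / t)%:E <= (C / - b * f s)%:E)%E.
Proof.
move=> mD Ds s0 b0 C0 fC.
have DP : D `<=` pos.
  by move=> t /Ds; rewrite /= !in_itv/= !andbT; exact: lt_le_trans.
have b1 : b - 1 < -1 by lra.
apply: (@le_trans _ _ ((C * s `^ (- b) * f s)%:E *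
    \int[mu]_(t in D) (t `^ (b - 1))%:E)%E).
  apply: int_leZ => //; first exact: measurable_pos_powR (@measurable_pos_id R).
  - by rewrite !mulr_ge0 ?powR_ge0 ?f0'.
  - by move=> t _; exact: powR_ge0.
  - move=> t Dt; have := DP _ Dt; rewrite in_pos => t0; rewrite B0'//=.
    have ti : 0 <= t^-1 by rewrite invr_ge0 ltW.
    apply: (le_trans (ler_wpM2r ti (fC _ Dt))).
    rewrite powRM ?invr_ge0 ?(ltW t0) ?(ltW s0)//.
    rewrite -(powR_inv1 (ltW s0)) -(powR_inv1 (ltW t0)) -powRrM mulN1r.
    rewrite powRD; last by apply/implyP => _; rewrite gt_eqF.
    by rewrite le_eqVlt; apply/orP; left; apply/eqP; ring.
apply: (@le_trans _ _ ((C * s `^ (- b) * f s)%:E *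
    (s `^ (b - 1 + 1) / - (b - 1 + 1))%:E)%E).
  rewrite lee_wpmul2l ?lee_fin ?mulr_ge0 ?powR_ge0 ?f0'//.
  exact: int_powR_tail.
rewrite -EFinM lee_fin le_eqVlt; apply/orP; left; apply/eqP.
rewrite subrK powRN.
have sb : s `^ b != 0 by rewrite gt_eqF ?powR_gt0.
have bn : b != 0 by rewrite lt_eqF.
by field; rewrite ?sb ?bn.
Qed.

Lemma int_ge_cst D (g : R -> R) a b k : measurable D -> D `<=` pos ->
  measurable_fun pos g -> (forall t, 0 < t -> 0 <= g t) ->
  `[a, b] `<=` D -> a <= b -> 0 <= k ->
  (forall t, a <= t <= b -> k <= g t) ->
  ((k * (b - a))%:E <= \int[mu]_(t in D) (g t)%:E)%E.
Proof.
move=> mD DP mg g0 abD ab k0 kg.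
apply: (@le_trans _ _ (\int[mu]_(t in `[a, b]) (g t)%:E)%E); last first.
  exact: int_sub.
apply: (@le_trans _ _ (\int[mu]_(t in `[a, b]) k%:E)%E); last first.
  apply: int_le => //; first exact: subset_trans DP.
  by move=> t /=; rewrite in_itv/= => /kg ->; rewrite k0.
rewrite integral_cst//= lebesgue_measure_itv/= lte_fin.
have [ab'|ba] := ltP a b; first by rewrite -EFinB -EFinM.
have -> : a = b by apply/eqP; rewrite eq_le ab ba.
by rewrite subrr mulr0 mule0.
Qed.

(** The top dyadic block [s / 2, s] already carries a fixed proportion of what
    [int_moment_le] allows. *)
Lemma int_moment_ge D s c : measurable D -> D `<=` pos -> 0 < s ->
  `[s / 2, s] `<=` D -> 0 <= c ->
  (forall t, s / 2 <= t <= s -> c * f s <= f t) ->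
  ((c * 2 `^ (- 1 - alpha) * (s `^ (1 + alpha) * f s))%:E <=
   \int[mu]_(t in D) (t `^ alpha * f t)%:E)%E.
Proof.
move=> mD DP s0 sD c0 cf.
have s20 : 0 < s / 2 by rewrite divr_gt0.
have -> : c * 2 `^ (- 1 - alpha) * (s `^ (1 + alpha) * f s) =
    (s / 2) `^ alpha * (c * f s) * (s - s / 2).
  have -> : s - s / 2 = s / 2 by field.
  have -> : - 1 - alpha = - (1 + alpha) by ring.
  rewrite powRN !powRD; try by apply/implyP => _; rewrite gt_eqF.
  rewrite !powRr1 ?(ltW s0)// powRM ?(ltW s0) ?invr_ge0//.
  have -> : (2^-1 : R) `^ alpha = (2 `^ alpha)^-1.
    by rewrite -powR_inv1// -powRrM mulN1r powRN.
  have : 2 `^ alpha != 0 :> R by rewrite gt_eqF ?powR_gt0.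
  by move=> ?; field.
apply: int_ge_cst => //.
- by move: s0; lra.
- by rewrite !mulr_ge0 ?powR_ge0 ?f0'.
- move=> t /[dup] /cf cft /andP[st ts].
  rewrite ler_pM ?powR_ge0 ?mulr_ge0 ?f0'//.
  apply: (ge0_ler_powR (ltW alpha0)) => //; rewrite nnegrE ltW//.
  exact: lt_le_trans st.
Qed.

(** The bottom dyadic block [s, 2 s] plays the same role for the tail. *)
Lemma int_tail_ge D s c : measurable D -> D `<=` pos -> 0 < s ->
  `[s, 2 * s] `<=` D -> 0 <= c ->
  (forall t, s <= t <= 2 * s -> c * f s <= f t) ->
  ((c / 2 * f s)%:E <= \int[mu]_(t in D) (f t / t)%:E)%E.
Proof.
move=> mD DP s0 sD c0 cf.
have -> : c / 2 * f s = (c * f s) / (2 * s) * (2 * s - s).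
  by field; rewrite (gt_eqF s0).
apply: int_ge_cst => //.
- by move: s0; lra.
- by rewrite divr_ge0 ?mulr_ge0 ?f0' ?(ltW s0).
- move=> t /[dup] /cf cft /andP[st ts].
  have t0 : 0 < t by exact: lt_le_trans st.
  apply: ler_pM => //; first by rewrite mulr_ge0 ?f0'.
    by rewrite invr_ge0 mulr_ge0// ltW.
  by rewrite lef_pV2 ?posrE ?mulr_gt0.
Qed.

(** * The Stieltjes transform that governs both q(x, y) and q(y, x) *)

Hypothesis f1 : (\int[mu]_(t in pos) (f t)%:E <= 1)%E.

(** Since (x + y / t) ^ (-1 - alpha) / t = t ^ alpha (x t + y) ^ (-1 - alpha),
    the density q(x, y) is x ^ (-1 - alpha) times this generalized Stieltjes
    transform of t ^ alpha f(t) at s = y / x, up to the factor c_-. *)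
Definition stieltjes s : \bar R :=
  (\int[mu]_(t in pos) (t `^ alpha * (t + s) `^ (- 1 - alpha) * f t)%:E)%E.

Lemma ler_powR_npos (a u v : R) : a <= 0 -> 0 < u -> u <= v -> v `^ a <= u `^ a.
Proof.
move=> a0 u0 uv; have v0 : 0 < v by exact: lt_le_trans uv.
rewrite /powR !gt_eqF// ler_expR.
have : ln u <= ln v by rewrite ler_ln ?posrE.
by nra.
Qed.

Let exp0 : - 1 - alpha <= 0.
Proof. by have := alpha0; lra. Qed.

Let measurable_kernel s : 0 < s ->
  measurable_fun pos (fun t => t `^ alpha * (t + s) `^ (- 1 - alpha) * f t).
Proof.
move=> s0; apply: measurable_pos_mul => //.
apply: measurable_pos_mul; apply: measurable_pos_powR.
  exact: measurable_pos_id.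
by apply: measurable_pos_add; [exact: measurable_pos_id|exact: measurable_cst].
Qed.

Let kernel_gt0 s t : 0 < s -> 0 < t ->
  0 < t `^ alpha * (t + s) `^ (- 1 - alpha) * f t.
Proof. by move=> s0 t0; rewrite !mulr_gt0 ?powR_gt0 ?addr_gt0 ?f0. Qed.

Let kernel_ge0 s t : 0 < s -> 0 < t ->
  0 <= t `^ alpha * (t + s) `^ (- 1 - alpha) * f t.
Proof. by move=> s0 /(kernel_gt0 s0)/ltW. Qed.

Lemma stieltjes_ge0 s : 0 < s -> (0 <= stieltjes s)%E.
Proof.
by move=> s0; apply: int_ge0 => t; rewrite in_pos; exact: kernel_ge0.
Qed.

Let powR_tail t : 0 < t -> t `^ alpha * t `^ (- 1 - alpha) * f t = f t / t.
Proof.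
move=> t0; rewrite -powRD; last by apply/implyP => _; rewrite gt_eqF.
have -> : alpha + (- 1 - alpha) = - 1 by ring.
by rewrite powR_inv1 ?ltW// mulrC.
Qed.

Let itv_pos s (l : bool) (b : itv_bound R) : 0 < s ->
  [set` Interval (BSide l s) b] `<=` pos.
Proof.
move=> s0 t; rewrite in_pos /= in_itv => /andP[+ _].
by case: l => /=; [exact: lt_le_trans|exact: lt_trans].
Qed.

Let itv0_pos (b : itv_bound R) : [set` Interval (BRight 0) b] `<=` pos.
Proof. by move=> t; rewrite in_pos /= in_itv => /andP[]. Qed.

(** The sum t + s is within a factor 2 of its larger term. Replacing it by s
    for t <= s and by t for t > s splits the transform into a truncated moment
    and a tail; this and the two lower bounds below are the two halves of that
    comparison. *)
Lemma stieltjes_le s : 0 < s ->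
  (stieltjes s <= (s `^ (- 1 - alpha))%:E *
            \int[mu]_(t in `]0%R, s]) (t `^ alpha * f t)%:E +
          \int[mu]_(t in `]s, +oo[) (f t / t)%:E)%E.
Proof.
move=> s0.
have sub1 : `]0, s]%classic `<=` pos by exact: itv0_pos.
have sub2 : `]s, +oo[%classic `<=` pos by exact: itv_pos.
have -> : stieltjes s = (\int[mu]_(t in `]0%R, s] `|` `]s, +oo[)
    (t `^ alpha * (t + s) `^ (- 1 - alpha) * f t)%:E)%E.
  congr integral; apply/seteqP; split=> t /=; rewrite !in_itv/= !andbT.
    by move=> t0; have [ts|ts] := leP t s; [left; rewrite t0|right].
  by move=> [/andP[]//|]; exact: lt_trans.
apply: le_trans (int_setU_le _ _ _ (measurable_kernel s0) _) _ => //.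
- by move=> t [/sub1|/sub2].
- by move=> t; exact: kernel_ge0.
apply: leeD.
  apply: int_leZ => //; first exact: measurable_kernel.
  - exact: powR_ge0.
  - by move=> t /sub1; rewrite in_pos; exact: A0'.
  - move=> t /sub1; rewrite in_pos => t0; rewrite kernel_ge0//=.
    rewrite mulrA ler_wpM2r ?f0'// mulrC ler_wpM2r ?powR_ge0//.
    by rewrite ler_powR_npos// lerDr ltW.
apply: int_le => //; first exact: measurable_kernel.
move=> t /sub2; rewrite in_pos => t0; rewrite kernel_ge0//=.
rewrite -powR_tail// ler_wpM2r ?f0'// ler_wpM2l ?powR_ge0//.
by rewrite ler_powR_npos// lerDl ltW.
Qed.

Lemma stieltjes_ge_moment s : 0 < s ->
  ((2 `^ (- 1 - alpha))%:E * ((s `^ (- 1 - alpha))%:E *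
     \int[mu]_(t in `]0%R, s]) (t `^ alpha * f t)%:E) <= stieltjes s)%E.
Proof.
move=> s0; rewrite muleA -EFinM -powRM ?(ltW s0)//.
have sub1 : `]0, s]%classic `<=` pos by exact: itv0_pos.
apply: (@le_trans _ _ (\int[mu]_(t in `]0%R, s])
    (t `^ alpha * (t + s) `^ (- 1 - alpha) * f t)%:E)%E); last first.
  apply: int_sub => //; first exact: measurable_kernel.
  by move=> t; exact: kernel_ge0.
apply: int_geZ => //; first exact: measurable_kernel.
- exact: powR_ge0.
- by move=> t /sub1; rewrite in_pos; exact: A0'.
move=> t /[dup] /sub1; rewrite in_pos => t0; rewrite /= in_itv/= => /andP[_ ts].
rewrite mulrA ler_wpM2r ?f0'// mulrC ler_wpM2l ?powR_ge0//.
by rewrite ler_powR_npos ?addr_gt0// mulr_natl mulr2n lerD2r.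
Qed.

Lemma stieltjes_ge_tail s D : measurable D -> D `<=` `[s, +oo[ -> 0 < s ->
  ((2 `^ (- 1 - alpha))%:E * \int[mu]_(t in D) (f t / t)%:E <= stieltjes s)%E.
Proof.
move=> mD Ds s0.
have DP : D `<=` pos by apply: subset_trans Ds _; exact: itv_pos.
apply: (@le_trans _ _ (\int[mu]_(t in D)
    (t `^ alpha * (t + s) `^ (- 1 - alpha) * f t)%:E)%E); last first.
  apply: int_sub => //; first exact: measurable_kernel.
  by move=> t; exact: kernel_ge0.
apply: int_geZ => //; first exact: measurable_kernel.
  by move=> t /DP; rewrite in_pos; exact: B0'.
move=> t /[dup] /DP; rewrite in_pos => t0 /Ds; rewrite /= in_itv/= andbT => st.
rewrite -powR_tail// mulrA mulrCA -powRM ?(ltW t0)// ler_wpM2r ?f0'//.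
rewrite ler_wpM2l ?powR_ge0//.
by rewrite ler_powR_npos ?addr_gt0// mulr_natl mulr2n lerD2l.
Qed.

Lemma int_tail_le_mass s D : measurable D -> D `<=` `[s, +oo[ -> 0 < s ->
  (\int[mu]_(t in D) (f t / t)%:E <= (s^-1)%:E)%E.
Proof.
move=> mD Ds s0.
have DP : D `<=` pos by apply: subset_trans Ds _; exact: itv_pos.
apply: (@le_trans _ _ ((s^-1)%:E * \int[mu]_(t in D) (f t)%:E)%E).
  apply: int_leZ => //; first by rewrite invr_ge0 ltW.
    by move=> t /DP; rewrite in_pos; exact: f0'.
  move=> t /[dup] /DP; rewrite in_pos => t0 /Ds /=; rewrite in_itv/= andbT => st.
  by rewrite B0'//= mulrC ler_wpM2r ?f0'// lef_pV2.
rewrite -[leRHS]mule1 lee_wpmul2l ?lee_fin ?invr_ge0 ?(ltW s0)//.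
by apply: le_trans f1; exact: int_sub.
Qed.

Lemma int_moment_le_mass D : measurable D -> D `<=` `]0, 1] ->
  (\int[mu]_(t in D) (t `^ alpha * f t)%:E <= 1)%E.
Proof.
move=> mD D1.
have DP : D `<=` pos by apply: subset_trans D1 _; exact: itv0_pos.
apply: le_trans f1; apply: (@le_trans _ _ (\int[mu]_(t in D) (f t)%:E)%E).
  apply: int_le => // t /[dup] /DP; rewrite in_pos => t0 /D1 /=.
  rewrite in_itv/= => /andP[_ t1]; rewrite A0'//= ler_piMl ?f0'//.
  have := @ge0_ler_powR _ _ (ltW alpha0) t 1; rewrite powR1; apply => //.
    by rewrite nnegrE ltW.
  by rewrite nnegrE.
exact: int_sub.
Qed.

Lemma stieltjes1_fin_gt0 : exists2 r : R, 0 < r & stieltjes 1 = r%:E.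
Proof.
have J_gt0 : (0 < stieltjes 1)%E.
  apply: int_gt0 => //; first exact: measurable_kernel.
    by move=> t; exact: kernel_gt0.
  by rewrite lebesgue_measure_itv/= ltry addye ?ltry.
have J_lty : (stieltjes 1 < +oo)%E.
  apply: le_lt_trans (stieltjes_le ltr01) _; rewrite powR1 mul1e.
  apply: lte_add_pinfty.
    by apply: le_lt_trans (int_moment_le_mass _ _) _; rewrite ?ltry.
  apply: le_lt_trans (int_tail_le_mass (s := 1) _ _ _) _ => //; last exact: ltry.
  by move=> t; rewrite /= !in_itv/= !andbT => /ltW.
have Jfin : stieltjes 1 \is a fin_num by rewrite ge0_fin_numE// ltW.
by exists (fine (stieltjes 1)); [rewrite fine_gt0// J_gt0|rewrite fineK].
Qed.

Lemma gt0_lower_bound (m : \bar R) : (0 < m)%E ->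
  exists2 r : R, 0 < r & (r%:E <= m)%E.
Proof.
case: m => [r|_|//]; last by exists 1 => //; rewrite leey.
by rewrite lte_fin => r0; exists r.
Qed.

(** A lower scaling condition read backwards bounds f at the smaller of the two
    points, which is the form that [int_moment_le] takes. *)
Lemma lower_scaling_bound b c (r s : R) : 0 < c -> 0 < r -> 0 < s ->
  c * (s / r) `^ b <= f s / f r -> f r <= c^-1 * (r / s) `^ b * f s.
Proof.
move=> c0 r0 s0; have fr := f0 r0; have fs := f0 s0.
rewrite ler_pdivlMr// => H.
have rsb : 0 < (s / r) `^ b by rewrite powR_gt0 ?divr_gt0.
have -> : (r / s) `^ b = ((s / r) `^ b)^-1.
  rewrite -[in RHS]powR_inv1 ?powR_ge0// -powRrM mulrN1 -invf_div.
  by rewrite -(@powR_inv1 _ (s / r)) ?divr_ge0 ?(ltW s0) ?(ltW r0)// -powRrM mulN1r.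
by rewrite -invfM mulrC ler_pdivlMr ?mulr_gt0// mulrC.
Qed.

Lemma powR_ratio_ge b (r s : R) : 0 < r -> r <= s -> s <= 2 * r ->
  (2 `^ `|b|)^-1 <= (s / r) `^ b.
Proof.
move=> r0 rs s2r; have s0 : 0 < s by exact: lt_le_trans rs.
have sr0 : 0 < s / r by rewrite divr_gt0.
have [||+ _] := @powR_cmp R 2 (s / r) 1 b (ltr0Sn R 1) sr0 ltr01.
- rewrite mulr1 ler_pdivlMr//; move: r0 rs; lra.
- by rewrite mulr1 ler_pdivrMr.
- by rewrite powR1 mulr1.
Qed.

Lemma powR_ratio_le1 b (r s : R) : b <= 0 -> 0 < r -> r <= s ->
  (s / r) `^ b <= 1.
Proof.
move=> b0 r0 rs; have := @ler_powR_npos b 1 (s / r) b0 ltr01.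
by rewrite powR1; apply; rewrite ler_pdivlMr// mul1r.
Qed.

(** * Behaviour near zero *)

Let near_zero (s _ : R) : Prop := 0 < s <= 4^-1.
Let tail s : \bar R := (\int[mu]_(t in `[s, 1%R]) (f t / t)%:E)%E.

Let tail_ge0 s : 0 < s -> (0 <= tail s)%E.
Proof.
by move=> s0; apply: int_ge0 => t /itv_pos; rewrite in_pos => /(_ s0)/B0'.
Qed.

Section NearZero.
Variable b1 : R.
Hypothesis b1_gt : - 1 - alpha < b1.
Hypothesis L1 : lower_scaling0 b1 f.

(** Lower scaling keeps f above a multiple of f s on [s, 2 s], and s <= 1 / 4
    keeps this block inside the range ]0, 1[ of the condition. *)
Lemma tail_ge : exists2 k : R, 0 < k &
  forall s, 0 < s <= 4^-1 -> (k%:E * (f s)%:E <= tail s)%E.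
Proof.
have [c /andP[c0 _] cf] := L1.
have k0 : 0 < (2 `^ `|b1|)^-1 :> R by rewrite invr_gt0 powR_gt0.
exists (c * (2 `^ `|b1|)^-1 / 2); first by rewrite !divr_gt0// mulr_gt0.
move=> s /andP[s0 s4]; rewrite -EFinM.
apply: int_tail_ge => //; first exact: itv_pos.
- by move=> t /=; rewrite !in_itv/= => /andP[-> ts]; move: s4 ts; lra.
- by rewrite mulr_ge0 ?(ltW c0) ?(ltW k0).
move=> t /andP[st ts]; have t0 : 0 < t by exact: lt_le_trans st.
have t1 : t < 1 by move: s4 ts; lra.
have := cf _ _ s0 st t1; rewrite ler_pdivlMr ?f0//; apply: le_trans.
rewrite ler_wpM2r ?f0'// ler_wpM2l ?(ltW c0)//.
exact: powR_ratio_ge.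
Qed.

(** The tail over [s, 1] dominates the two other contributions: the moment term
    of [stieltjes_le] is O(f s) by lower scaling, hence O(tail s) by [tail_ge];
    the tail over ]1, +oo[ is at most the mass of f, a constant, which is absorbed by
    tail (1 / 4), the smallest value of tail on the range considered. *)
Lemma stieltjes_cmp_tail :
  comparable_on near_zero (fun s _ => stieltjes s) (fun s _ => tail s).
Proof.
have [k k0 kf] := tail_ge.
have [c /andP[c0 _] cf] := L1.
have [r r0 rK] : exists2 r : R, 0 < r & (r%:E <= tail 4^-1)%E.
  apply: gt0_lower_bound; apply: int_gt0 => //; first exact: itv_pos.
  rewrite lebesgue_measure_itv/= lte_fin ifT; last by lra.
  by rewrite -EFinB lte_fin; lra.
(* tail decreases in s, so its value at 1 / 4 bounds it below on the range *)
have rle s : near_zero s s -> (1 <= (r^-1)%:E * tail s)%E.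
  move=> /andP[s0 s4]; rewrite -(@lee_pmul2l _ r%:E)// ?lte_fin//.
  rewrite mule1 muleA -EFinM divff ?gt_eqF// mul1e (le_trans rK)//.
  apply: int_sub => //; first exact: itv_pos.
  by move=> t /=; rewrite !in_itv/= => /andP[+ ->]; rewrite andbT; exact: le_trans.
(* C is the constant of [int_moment_le]. *)
pose C := c^-1 / (alpha + b1 + 1).
have C0 : 0 <= C by rewrite divr_ge0 ?invr_ge0 ?(ltW c0)//; move: b1_gt; lra.
have kV : 0 <= k^-1 by rewrite invr_ge0 ltW.
have rV : 0 <= r^-1 by rewrite invr_ge0 ltW.
apply: (@cmp_intro _ _ _ _ (C * k^-1 + (1 + r^-1)) (2 `^ (- 1 - alpha))^-1).
- by rewrite addr_ge0 ?(mulr_ge0 C0)// addr_ge0.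
- by rewrite invr_ge0 powR_ge0.
- by move=> s _ /andP[s0 _]; exact: stieltjes_ge0.
- by move=> s _ /andP[s0 _]; exact: tail_ge0.
- move=> s y sD; have /andP[s0 s4] := sD.
  apply: le_trans (stieltjes_le s0) _.
  rewrite EFinD ge0_muleDl ?lee_fin; [|exact: mulr_ge0|exact: addr_ge0].
  apply: leeD.
    apply: (@le_trans _ _ (C%:E * (f s)%:E)%E); last first.
      rewrite (EFinM C) -muleA lee_wpmul2l ?lee_fin// -lee_pmul_inv ?invr_gt0//.
      by rewrite invrK; exact: kf.
    apply: (@le_trans _ _ ((s `^ (- 1 - alpha))%:E *
        (C * (s `^ (1 + alpha) * f s))%:E)%E).
      rewrite lee_wpmul2l ?lee_fin ?powR_ge0//.
      apply: int_moment_le => //; first by rewrite invr_ge0 (ltW c0).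
      move=> t /=; rewrite in_itv/= => /andP[t0 ts].
      apply: lower_scaling_bound => //; apply: cf => //.
      by move: s4; lra.
    rewrite -EFinM lee_fin mulrCA ler_wpM2l// mulrA -powRD; last first.
      by apply/implyP => _; rewrite gt_eqF.
    have -> : - 1 - alpha + (1 + alpha) = 0 by ring.
    by rewrite powRr0 mul1r.
  rewrite EFinD ge0_muleDl ?lee_fin// mul1e.
  apply: (@le_trans _ _ (tail s + \int[mu]_(t in `]1%R, +oo[) (f t / t)%:E)%E).
    apply: le_trans (int_setU_le _ _ _ mB B0') => //.
      apply: int_sub => //; first exact: measurableU.
        by move=> t [|]; exact: itv_pos.
      move=> t /=; rewrite !in_itv/= !andbT => st.
      by have [t1|t1] := leP t 1; [left; rewrite ltW|right].
    by move=> t [|]; exact: itv_pos.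
  rewrite leeD2l//; apply: le_trans (rle _ sD).
  apply: le_trans (int_tail_le_mass (s := 1) _ _ _) _ => //; last by rewrite invr1.
  by move=> t; rewrite /= !in_itv/= !andbT => /ltW.
- move=> s _ /andP[s0 _]; rewrite -lee_pmul_inv ?invr_gt0 ?powR_gt0// invrK.
  by apply: stieltjes_ge_tail => // t; rewrite /= !in_itv/= andbT => /andP[].
Qed.

Section Upper.
Variable b2 : R.
Hypothesis b2_lt0 : b2 < 0.
Hypothesis U1 : upper_scaling0 b2 f.

(** A negative upper exponent makes f decay fast enough away from s for the
    whole tail to be of the order of its first dyadic block. *)
Lemma tail_cmp_density :
  comparable_on near_zero (fun s _ => tail s) (fun s _ => (f s)%:E).
Proof.
have [k k0 kf] := tail_ge.
have [C C1 Cf] := U1.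
have C0 : 0 <= C by exact: le_trans C1.
apply: (@cmp_intro _ _ _ _ (C / - b2) k^-1).
- by rewrite divr_ge0// oppr_ge0 ltW.
- by rewrite invr_ge0 ltW.
- by move=> s _ /andP[s0 _]; exact: tail_ge0.
- by move=> s _ /andP[s0 _]; rewrite lee_fin f0'.
- move=> s _ /andP[s0 s4]; rewrite /tail -integral_itv_bndo_bndc; last first.
    by apply/measurable_EFinP; apply: measurable_pos_sub mB; exact: itv_pos.
  apply: int_tail_le => //.
    by move=> t; rewrite /= !in_itv/= => /andP[->].
  move=> t; rewrite /= !in_itv/= => /andP[st t1].
  by rewrite -ler_pdivrMr ?f0//; exact: Cf.
- move=> s y s4; rewrite -lee_pmul_inv ?invr_gt0// invrK.
  exact: kf.
Qed.

Lemma density0_cmp (D : R -> R -> Prop) (u v : R -> R -> R) :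
  (forall x y, D x y ->
     [/\ 0 < u x y, u x y <= v x y, v x y <= 2 * u x y & v x y < 1]) ->
  comparable_on D (fun x y => (f (v x y))%:E) (fun x y => (f (u x y))%:E).
Proof.
move=> Duv; have [C C1 Cf] := U1; have [c /andP[c0 _] cf] := L1.
have C0 : 0 <= C by exact: le_trans C1.
have k0 : 0 < (2 `^ `|b1|)^-1 :> R by rewrite invr_gt0 powR_gt0.
apply: (@cmp_intro _ _ _ _ C (c * (2 `^ `|b1|)^-1)^-1) => //.
- by rewrite invr_ge0 mulr_ge0 ?(ltW c0) ?(ltW k0).
- by move=> x y /Duv[u0 uv _ _]; rewrite lee_fin f0' ?(lt_le_trans u0).
- by move=> x y /Duv[u0 uv _ _]; rewrite lee_fin f0'.
- move=> x y /Duv[u0 uv v2u v1]; rewrite -EFinM lee_fin.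
  rewrite -ler_pdivrMr ?f0//; apply: le_trans (Cf _ _ u0 uv v1) _.
  by rewrite ler_piMr ?powR_ratio_le1// ltW.
- move=> x y /Duv[u0 uv v2u v1]; rewrite -lee_pmul_inv ?invr_gt0 ?mulr_gt0// invrK.
  rewrite -EFinM lee_fin -ler_pdivlMr ?f0//; apply: le_trans (cf _ _ u0 uv v1).
  by rewrite ler_wpM2l ?(ltW c0)// powR_ratio_ge.
Qed.

End Upper.
End NearZero.

(** * Behaviour near infinity *)

Let near_infinity (s _ : R) : Prop := 4 <= s.
Let moment s : \bar R := (\int[mu]_(t in `]0%R, s]) (t `^ alpha * f t)%:E)%E.
Let moment1 s : \bar R := (\int[mu]_(t in `[1%R, s]) (t `^ alpha * f t)%:E)%E.

Let moment_ge0 s : (0 <= moment s)%E.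
Proof. by apply: int_ge0 => t /itv0_pos; rewrite in_pos => /A0'. Qed.

Let moment1_ge0 s : (0 <= moment1 s)%E.
Proof.
by apply: int_ge0 => t /itv_pos; rewrite in_pos => /(_ ltr01)/A0'.
Qed.

Let moment1_le s : (moment1 s <= moment s)%E.
Proof.
apply: int_sub => //.
by move=> t /=; rewrite !in_itv/= => /andP[/(lt_le_trans ltr01) -> ->].
Qed.

(** On ]0, 1] the weight t ^ alpha is at most 1, so this part of the moment is
    at most the mass of f, which the moment over [1, 4] absorbs. *)
Lemma moment_cmp :
  comparable_on near_infinity (fun s _ => moment s) (fun s _ => moment1 s).
Proof.
have [r r0 rK] : exists2 r : R, 0 < r & (r%:E <= moment1 4)%E.
  apply: gt0_lower_bound; apply: int_gt0 => //; first exact: itv_pos.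
  rewrite lebesgue_measure_itv/= lte_fin ifT; last by lra.
  by rewrite -EFinB lte_fin; lra.
have rV : 0 <= r^-1 by rewrite invr_ge0 ltW.
apply: (@cmp_intro _ _ _ _ (r^-1 + 1) 1) => //; first exact: addr_ge0.
- move=> s y s4; rewrite EFinD ge0_muleDl ?lee_fin// mul1e.
  apply: (@le_trans _ _ (\int[mu]_(t in `]0%R, 1%R]) (t `^ alpha * f t)%:E +
                         moment1 s)%E).
    apply: le_trans (int_setU_le _ _ _ mA A0') => //.
      apply: int_sub => //; first exact: measurableU.
        by move=> t [|]; [exact: itv0_pos|exact: itv_pos].
      move=> t /=; rewrite !in_itv/= => /andP[t0 ts].
      by have [t1|t1] := leP t 1; [left; rewrite t0|right; rewrite (ltW t1)].
    by move=> t [|]; [exact: itv0_pos|exact: itv_pos].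
  rewrite leeD2r//; apply: (@le_trans _ _ 1%E); first exact: int_moment_le_mass.
  rewrite -(@lee_pmul2l _ r%:E)// ?lte_fin//.
  rewrite mule1 muleA -EFinM divff ?gt_eqF// mul1e (le_trans rK)//.
  apply: int_sub => //; first exact: itv_pos.
  move=> t /=; rewrite !in_itv/= => /andP[-> t4]; exact: le_trans s4.
- by move=> s y _; rewrite mul1e.
Qed.

Section NearInfinity.
Variable g2 : R.
Hypothesis g2_lt0 : g2 < 0.
Hypothesis Uoo : upper_scaling_oo g2 f.

(** As g2 < 0, f is almost decreasing on [1, +oo[, hence bounded below by a
    multiple of f s on [s / 2, s]; s >= 4 keeps this block above 1. *)
Lemma moment_ge : exists2 k : R, 0 < k &
  forall s, 4 <= s -> ((k * (s `^ (1 + alpha) * f s))%:E <= moment1 s)%E.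
Proof.
have [C C1 Cf] := Uoo.
have C0 : 0 < C by exact: lt_le_trans C1.
exists (C^-1 * 2 `^ (- 1 - alpha)); first by rewrite mulr_gt0 ?invr_gt0 ?powR_gt0.
move=> s s4; have s0 : 0 < s by exact: lt_le_trans s4.
apply: int_moment_ge => //; first exact: itv_pos.
- by move=> t /=; rewrite !in_itv/= => /andP[st ->]; move: s4 st; lra.
- by rewrite invr_ge0 ltW.
move=> t /andP[st ts]; have t1 : 1 <= t by move: s4 st; lra.
have t0 : 0 < t by exact: lt_le_trans t1.
rewrite ler_pdivrMl// -ler_pdivrMr ?f0//; apply: le_trans (Cf _ _ t1 ts) _.
by rewrite ler_piMr ?(ltW C0)// powR_ratio_le1// ltW.
Qed.

(** Upper scaling makes the tail over ]s, +oo[ an O(f s), which by [moment_ge]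
    is absorbed by the moment term of [stieltjes_le]. *)
Lemma stieltjes_cmp_moment : comparable_on near_infinity (fun s _ => stieltjes s)
  (fun s _ => (s `^ (- 1 - alpha))%:E * moment s)%E.
Proof.
have [k k0 kf] := moment_ge; have [C C1 Cf] := Uoo.
have C0 : 0 <= C by exact: le_trans C1.
have s_gt0 s : 4 <= s -> 0 < s by exact: lt_le_trans.
have Cg : 0 <= C / - g2 by rewrite divr_ge0// oppr_ge0 ltW.
apply: (@cmp_intro _ _ _ _ (1 + C / - g2 * k^-1) (2 `^ (- 1 - alpha))^-1).
- by rewrite addr_ge0// mulr_ge0// invr_ge0 ltW.
- by rewrite invr_ge0 powR_ge0.
- by move=> s y /s_gt0; exact: stieltjes_ge0.
- by move=> s y _; rewrite mule_ge0// lee_fin powR_ge0.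
- move=> s y s4; have s0 := s_gt0 _ s4.
  apply: le_trans (stieltjes_le s0) _.
  rewrite EFinD ge0_muleDl ?lee_fin//; last by rewrite mulr_ge0// invr_ge0 ltW.
  rewrite mul1e leeD2l//.
  apply: (@le_trans _ _ ((C / - g2 * f s)%:E)).
    apply: int_tail_le => //.
      by move=> t; rewrite /= !in_itv/= !andbT; exact: ltW.
    move=> t; rewrite /= !in_itv/= andbT => st; rewrite -ler_pdivrMr ?f0//.
    by apply: Cf; [apply: le_trans s4; rewrite ler1n|exact: ltW].
  rewrite (EFinM (C / - g2)) (EFinM (C / - g2)) -muleA lee_wpmul2l ?lee_fin//.
  rewrite -lee_pmul_inv ?invr_gt0// invrK.
  apply: (@le_trans _ _ ((s `^ (- 1 - alpha))%:E *
      (k * (s `^ (1 + alpha) * f s))%:E)%E); last first.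
    by rewrite lee_wpmul2l ?lee_fin ?powR_ge0// (le_trans (kf _ s4)).
  rewrite -!EFinM lee_fin mulrCA ler_pM2l// mulrA -powRD; last first.
    by apply/implyP => _; rewrite gt_eqF.
  have -> : - 1 - alpha + (1 + alpha) = 0 by ring.
  by rewrite powRr0 mul1r.
- move=> s y /s_gt0 s0; rewrite -lee_pmul_inv ?invr_gt0 ?powR_gt0// invrK.
  exact: stieltjes_ge_moment.
Qed.

Section Lower.
Variable g1 : R.
Hypothesis g1_gt : - 1 - alpha < g1.
Hypothesis Loo : lower_scaling_oo g1 f.

(** For g1 > -1 - alpha the moment over [1, s] is governed by its upper end, so
    that it is of the order of its top dyadic block. *)
Lemma moment_cmp_density : comparable_on near_infinity (fun s _ => moment s)
  (fun s _ => ((s^-1) `^ (- 1 - alpha) * f s)%:E).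
Proof.
have [k k0 kf] := moment_ge; have [c /andP[c0 _] cf] := Loo.
have s_gt0 s : 4 <= s -> 0 < s by exact: lt_le_trans.
have C0 : 0 <= c^-1 / (alpha + g1 + 1).
  by rewrite divr_ge0 ?invr_ge0 ?(ltW c0)//; move: g1_gt; lra.
have powV s : 4 <= s -> (s^-1) `^ (- 1 - alpha) = s `^ (1 + alpha).
  move=> /s_gt0 s0; rewrite -(powR_inv1 (ltW s0)) -powRrM.
  by congr (_ `^ _); ring.
apply: (cmp_trans moment_cmp).
apply: (@cmp_intro _ _ _ _ (c^-1 / (alpha + g1 + 1)) k^-1) => //.
- by rewrite invr_ge0 ltW.
- by move=> s y /s_gt0 s0; rewrite lee_fin mulr_ge0 ?powR_ge0 ?f0'.
- move=> s y s4; rewrite powV// -EFinM; have s0 := s_gt0 _ s4.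
  apply: int_moment_le => //; last first.
  + move=> t; rewrite /= in_itv/= => /andP[t1 ts].
    have t0 : 0 < t by exact: lt_le_trans t1.
    by apply: lower_scaling_bound => //; exact: cf.
  + by rewrite invr_ge0 ltW.
  + by move=> t; rewrite /= !in_itv/= => /andP[/(lt_le_trans ltr01) -> ->].
- move=> s y s4; rewrite powV// -lee_pmul_inv ?invr_gt0// invrK.
  exact: kf.
Qed.

Lemma densityoo_cmp (D : R -> R -> Prop) (u v : R -> R -> R) :
  (forall x y, D x y -> [/\ 1 <= u x y, u x y <= v x y & v x y <= 2 * u x y]) ->
  comparable_on D (fun x y => (f (u x y))%:E) (fun x y => (f (v x y))%:E).
Proof.
move=> Duv; have [C C1 Cf] := Uoo; have [c /andP[c0 _] cf] := Loo.
have C0 : 0 <= C by exact: le_trans C1.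
have k0 : 0 < (2 `^ `|g1|)^-1 :> R by rewrite invr_gt0 powR_gt0.
apply: cmp_sym.
apply: (@cmp_intro _ _ _ _ C (c * (2 `^ `|g1|)^-1)^-1) => //.
- by rewrite invr_ge0 mulr_ge0 ?(ltW c0) ?(ltW k0).
- move=> x y /Duv[/(lt_le_trans ltr01) u0 uv _].
  by rewrite lee_fin f0' ?(lt_le_trans u0).
- by move=> x y /Duv[/(lt_le_trans ltr01) u0 uv _]; rewrite lee_fin f0'.
- move=> x y /Duv[u1 uv v2u]; have u0 := lt_le_trans ltr01 u1.
  rewrite -EFinM lee_fin -ler_pdivrMr ?f0//; apply: le_trans (Cf _ _ u1 uv) _.
  by rewrite ler_piMr ?powR_ratio_le1// ltW.
- move=> x y /Duv[u1 uv v2u]; have u0 := lt_le_trans ltr01 u1.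
  rewrite -lee_pmul_inv ?invr_gt0 ?mulr_gt0// invrK.
  rewrite -EFinM lee_fin -ler_pdivlMr ?f0//; apply: le_trans (cf _ _ u1 uv).
  by rewrite ler_wpM2l ?(ltW c0)// powR_ratio_ge.
Qed.

End Lower.
End NearInfinity.

(** * From the resurrection density to the transform *)

Variables (rho : R) (phi : probability (measurableTypeR R) R).
Hypothesis perm : permissible alpha rho.
Hypothesis phif : positive_density phi f.

Let q := resurrection_density alpha rho phi.

(** The kernel of q(X, Y) is t ^ alpha (X t + Y) ^ (-1 - alpha), and the one of
    the right-hand side is t ^ alpha (z t + z s) ^ (-1 - alpha): it suffices to
    compare X with z and Y with z s. The freedom in z and s is what replaces y
    by y - x in the results. *)
Lemma q_cmp (D : R -> R -> Prop) (X Y z s : R -> R -> R) (k : R) : 0 < k ->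
  (forall x y, D x y -> [/\ 0 < X x y, 0 < Y x y, 0 < z x y & 0 < s x y]) ->
  (forall x y, D x y -> k^-1 * z x y <= X x y <= k * z x y) ->
  (forall x y, D x y ->
     k^-1 * (z x y * s x y) <= Y x y <= k * (z x y * s x y)) ->
  comparable_on D (fun x y => q (X x y) (Y x y))
    (fun x y => (z x y `^ (- 1 - alpha))%:E * stieltjes (s x y))%E.
Proof.
move=> k0 D0 DX DY; have c0 := c_minus_gt0 perm.
have mK x y : 0 < x -> 0 < y -> measurable_fun pos
    (fun t => (x + y / t) `^ (- 1 - alpha) * t^-1).
  move=> x0 y0; have mV : measurable_fun pos (fun t => t^-1).
    by apply: measurable_pos_inv; [move=> t /ltW|exact: measurable_pos_id].
  apply: measurable_pos_mul => //; apply: measurable_pos_powR.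
  apply: measurable_pos_add.
    exact: measurable_cst.
  by apply: measurable_pos_mul => //; exact: measurable_cst.
have K0 x y t : 0 < x -> 0 < y -> 0 < t ->
    0 < (x + y / t) `^ (- 1 - alpha) * t^-1.
  by move=> x0 y0 t0; rewrite mulr_gt0 ?invr_gt0 ?powR_gt0 ?addr_gt0 ?divr_gt0.
have qE x y : 0 < x -> 0 < y -> q x y = ((c_minus alpha rho)%:E *
    \int[mu]_(t in pos) ((x + y / t) `^ (- 1 - alpha) * t^-1 * f t)%:E)%E.
  move=> x0 y0; rewrite /q /resurrection_density; congr (_ * _)%E.
  have [_ _ phiE] := phif.
  rewrite (@integral_density _ _ _ phi mu pos f)//.
  - by move=> t; rewrite in_pos; exact: f0'.
  - apply/measurable_EFinP; exact: mK.
  - by move=> t; rewrite in_pos => t0; rewrite lee_fin ltW// K0.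
pose I x y := (\int[mu]_(t in pos)
  ((X x y + Y x y / t) `^ (- 1 - alpha) * t^-1 * f t)%:E)%E.
have kernel x y t : D x y -> 0 < t ->
    let l := (X x y + Y x y / t) `^ (- 1 - alpha) * t^-1 * f t in
    let r := z x y `^ (- 1 - alpha) *
      (t `^ alpha * (t + s x y) `^ (- 1 - alpha) * f t) in
    l <= k `^ `|- 1 - alpha| * r /\ r <= k `^ `|- 1 - alpha| * l.
  move=> Dxy t0 /=; have [X0 Y0 z0 s0] := D0 _ _ Dxy.
  have -> : (X x y + Y x y / t) `^ (- 1 - alpha) * t^-1 * f t =
      t `^ alpha * f t * (X x y * t + Y x y) `^ (- 1 - alpha).
    have -> : X x y + Y x y / t = (X x y * t + Y x y) * t^-1.
      by field; rewrite gt_eqF.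
    rewrite powRM ?invr_ge0 ?(ltW t0) ?addr_ge0 ?mulr_ge0
      ?(ltW X0) ?(ltW Y0) ?(ltW t0)//.
    rewrite -[in X in X * f t](powR_inv1 (ltW t0)) -powRrM.
    rewrite -[_ * t `^ _ * t `^ _]mulrA -powRD; last first.
      by apply/implyP => _; rewrite gt_eqF.
    have -> : -1 * (- 1 - alpha) + -1 = alpha by ring.
    by ring.
  have -> : z x y `^ (- 1 - alpha) *
      (t `^ alpha * (t + s x y) `^ (- 1 - alpha) * f t) =
      t `^ alpha * f t * (z x y * (t + s x y)) `^ (- 1 - alpha).
    rewrite powRM ?(ltW z0) ?addr_ge0 ?(ltW t0) ?(ltW s0)//.
    by ring.
  have /andP[zX Xz] := DX _ _ Dxy; have /andP[zY Yz] := DY _ _ Dxy.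
  have kV : 0 < k^-1 by rewrite invr_gt0.
  have [] := @powR_cmp R k (X x y * t + Y x y) (z x y * (t + s x y))
    (- 1 - alpha) k0.
  - by rewrite addr_gt0// mulr_gt0.
  - by rewrite mulr_gt0// addr_gt0.
  - by move: zX zY; nra.
  - by move: Xz Yz; nra.
  move=> H1 H2; split.
    by rewrite mulrCA ler_wpM2l// ltW// A0.
  rewrite mulrCA ler_wpM2l ?(ltW (A0 t0))//.
  by rewrite -ler_pdivrMl// ?powR_gt0.
have mI x y : D x y -> measurable_fun pos
  (fun t => (X x y + Y x y / t) `^ (- 1 - alpha) * t^-1 * f t).
  by move=> /D0[X0 Y0 _ _]; apply: measurable_pos_mul => //; exact: mK.
have I0 x y t : D x y -> 0 < t ->
    0 <= (X x y + Y x y / t) `^ (- 1 - alpha) * t^-1 * f t.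
  by move=> Dxy t0; rewrite !mulr_ge0 ?powR_ge0 ?invr_ge0 ?(ltW t0) ?f0'.
have zJ x y : D x y -> ((z x y `^ (- 1 - alpha))%:E * stieltjes (s x y))%E =
    (\int[mu]_(t in pos) (z x y `^ (- 1 - alpha) *
      (t `^ alpha * (t + s x y) `^ (- 1 - alpha) * f t))%:E)%E.
  move=> Dxy; have [_ _ _ s0] := D0 _ _ Dxy; rewrite intZ ?powR_ge0//.
    exact: measurable_kernel.
  by move=> t; rewrite in_pos; exact: kernel_ge0.
have mz x y : D x y -> measurable_fun pos (fun t => z x y `^ (- 1 - alpha) *
      (t `^ alpha * (t + s x y) `^ (- 1 - alpha) * f t)).
  move=> Dxy; have [_ _ _ s0] := D0 _ _ Dxy.
  by apply: measurable_pos_mul;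
    [exact: measurable_cst|exact: measurable_kernel].
have z0 x y t : D x y -> 0 < t -> 0 <= z x y `^ (- 1 - alpha) *
      (t `^ alpha * (t + s x y) `^ (- 1 - alpha) * f t).
  move=> Dxy t0; have [_ _ _ s0] := D0 _ _ Dxy.
  by rewrite mulr_ge0 ?powR_ge0// kernel_ge0.
apply: (@cmp_intro _ _ _ _ (c_minus alpha rho * k `^ `|- 1 - alpha|)
    (k `^ `|- 1 - alpha| * (c_minus alpha rho)^-1)).
- by rewrite mulr_ge0 ?powR_ge0 ?(ltW c0).
- by rewrite mulr_ge0 ?powR_ge0 ?invr_ge0 ?(ltW c0).
- move=> x y Dxy; have [X0 Y0 _ _] := D0 _ _ Dxy; rewrite qE//.
  rewrite mule_ge0 ?lee_fin ?(ltW c0)//; apply: int_ge0 => t.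
  by rewrite in_pos; exact: I0.
- move=> x y Dxy; rewrite zJ//; apply: int_ge0 => t; rewrite in_pos; exact: z0.
- move=> x y Dxy; have [X0 Y0 _ _] := D0 _ _ Dxy; rewrite qE// zJ//.
  rewrite (EFinM (c_minus _ _)) -muleA lee_wpmul2l ?lee_fin ?(ltW c0)//.
  apply: int_leZ => //; [exact: mI|exact: mz|exact: powR_ge0|..] => t;
    rewrite in_pos => t0; first exact: z0.
  by rewrite I0//=; have [] := kernel _ _ _ Dxy t0.
- move=> x y Dxy; have [X0 Y0 _ _] := D0 _ _ Dxy; rewrite qE// zJ//.
  rewrite (EFinM (k `^ _)) -muleA (muleA _^-1%:E) -EFinM mulVf ?gt_eqF// mul1e.
  apply: int_leZ => //; [exact: mz|exact: mI|exact: powR_ge0|..] => t;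
    rewrite in_pos => t0; first exact: I0.
  by rewrite z0//=; have [] := kernel _ _ _ Dxy t0.
Qed.

Let near (x y : R) := 0 < x /\ x <= y <= 5 * x.
Let far (x y : R) := 0 < x /\ 5 * x <= y.

(** Here the two arguments are both of order x, and the transform is frozen at
    s = 1, where it is a positive number depending on alpha and f only. *)
Lemma q_near (X Y : R -> R -> R) :
  (forall x y, near x y -> x <= X x y <= 5 * x /\ x <= Y x y <= 5 * x) ->
  comparable_on near (fun x y => q (X x y) (Y x y))
    (fun x _ => (x `^ (- 1 - alpha))%:E).
Proof.
move=> XY; have [r r0 J1] := stieltjes1_fin_gt0.
apply: (@cmp_trans _ _ _ (fun x _ => (x `^ (- 1 - alpha))%:E * stieltjes 1)%E).
  apply: (@q_cmp near X Y (fun x _ => x) (fun _ _ => 1) 5) => //.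
  - move=> x y nxy; have [x0 _] := nxy.
    have [/andP[xX _] /andP[xY _]] := XY _ _ nxy.
    by split => //; exact: lt_le_trans x0 _.
  - move=> x y nxy; have [x0 _] := nxy; have [/andP[xX Xx] _] := XY _ _ nxy.
    by rewrite Xx andbT; move: x0 xX; lra.
  - move=> x y nxy; have [x0 _] := nxy; have [_ /andP[xX Xx]] := XY _ _ nxy.
    by rewrite mulr1 Xx andbT; move: x0 xX; lra.
apply: (@cmp_intro _ _ _ _ r r^-1); rewrite ?invr_ge0 ?(ltW r0)//.
- by move=> x y _; rewrite J1 -EFinM lee_fin mulr_ge0 ?powR_ge0 ?ltW.
- by move=> x y _; rewrite lee_fin powR_ge0.
- by move=> x y _; rewrite J1 muleC.
- by move=> x y _; rewrite J1 muleC -muleA -(EFinM r) divff ?gt_eqF// mule1.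
Qed.

Let near_cmp : comparable_on near (fun x y => (x `^ (- 1 - alpha))%:E)
  (fun x y => (y `^ (- 1 - alpha))%:E).
Proof.
apply: cmp_powR; first by move=> x y [].
  by move=> x y [x0 /andP[xy _]]; exact: lt_le_trans xy.
exists 5 => // x y [x0 /andP[xy y5]]; rewrite -!EFinM !lee_fin.
by split; [rewrite ler_pdivrMl|move: x0 xy; lra].
Qed.

Let far_sub x y : far x y -> 0 < y - x /\ 0 < y.
Proof. by move=> [x0 xy]; split; lra. Qed.

Let far_ratio x y : far x y -> 0 < x / (y - x) <= 4^-1.
Proof.
move=> fxy; have [yx0 _] := far_sub fxy; have [x0 xy] := fxy.
rewrite divr_gt0//= ler_pdivrMr//; lra.
Qed.

Let far_ratioV x y : far x y -> 4 <= (y - x) / x.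
Proof. by move=> [x0 xy]; rewrite ler_pdivlMr//; lra. Qed.

Let far_cmp : comparable_on far (fun x y => ((y - x) `^ (- 1 - alpha))%:E)
  (fun x y => (y `^ (- 1 - alpha))%:E).
Proof.
apply: cmp_powR; [by move=> x y /far_sub[]|by move=> x y /far_sub[]|].
exists 5 => // x y [x0 xy]; rewrite -!EFinM !lee_fin.
by split; lra.
Qed.

Let q_far_small : comparable_on far (fun x y => q y x)
  (fun x y => ((y - x) `^ (- 1 - alpha))%:E * stieltjes (x / (y - x)))%E.
Proof.
apply: (@q_cmp far (fun _ y => y) (fun x _ => x) (fun x y => y - x)
  (fun x y => x / (y - x)) 2) => //.
- move=> x y fxy; have [yx0 y0] := far_sub fxy; have [x0 _] := fxy.
  by rewrite divr_gt0.
- by move=> x y [x0 xy]; apply/andP; split; lra.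
- move=> x y fxy; have [yx0 y0] := far_sub fxy; have [x0 _] := fxy.
  have -> : (y - x) * (x / (y - x)) = x by rewrite mulrC divfK ?gt_eqF.
  by apply/andP; split; lra.
Qed.

Let q_far_large : comparable_on far (fun x y => q x y)
  (fun x y => (x `^ (- 1 - alpha))%:E * stieltjes ((y - x) / x))%E.
Proof.
apply: (@q_cmp far (fun x _ => x) (fun _ y => y) (fun x _ => x)
  (fun x y => (y - x) / x) 2) => //.
- move=> x y fxy; have [yx0 y0] := far_sub fxy; have [x0 _] := fxy.
  by rewrite divr_gt0.
- by move=> x y [x0 xy]; apply/andP; split; lra.
- move=> x y [x0 xy].
  have -> : x * ((y - x) / x) = y - x by rewrite mulrC divfK ?gt_eqF.
  by apply/andP; split; lra.
Qed.

Lemma q_near_cmps :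
  [/\ comparable_on near (fun x y => q x y) (fun x y => q y x),
      comparable_on near (fun x y => q y x) (fun x y => (x `^ (- 1 - alpha))%:E)
    & comparable_on near (fun x y => (x `^ (- 1 - alpha))%:E)
        (fun x y => (y `^ (- 1 - alpha))%:E)].
Proof.
have qxy : comparable_on near (fun x y => q x y)
    (fun x y => (x `^ (- 1 - alpha))%:E).
  apply: (@q_near (fun x _ => x) (fun _ y => y)) => x y [x0 xy].
  by split=> //; apply/andP; split; lra.
have qyx : comparable_on near (fun x y => q y x)
    (fun x y => (x `^ (- 1 - alpha))%:E).
  apply: (@q_near (fun _ y => y) (fun x _ => x)) => x y [x0 xy].
  by split=> //; apply/andP; split; lra.
by split => //; apply: cmp_trans qxy (cmp_sym qyx).
Qed.

Lemma q_far_zero (b1 : R) : - 1 - alpha < b1 -> lower_scaling0 b1 f ->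
  (comparable_on far (fun x y => q y x)
     (fun x y => ((y - x) `^ (- 1 - alpha))%:E * tail (x / (y - x)))%E /\
   comparable_on far
     (fun x y => ((y - x) `^ (- 1 - alpha))%:E * tail (x / (y - x)))%E
     (fun x y => (y `^ (- 1 - alpha))%:E * tail (x / (y - x)))%E) /\
  (forall b2 : R, b2 < 0 -> upper_scaling0 b2 f ->
   comparable_on far (fun x y => q y x)
     (fun x y => ((y - x) `^ (- 1 - alpha) * f (x / (y - x)))%:E) /\
   comparable_on far
     (fun x y => ((y - x) `^ (- 1 - alpha) * f (x / (y - x)))%:E)
     (fun x y => (y `^ (- 1 - alpha) * f (x / y))%:E)).
Proof.
move=> b1_gt L1.
have tail0 x y : far x y -> (0 <= tail (x / (y - x)))%E.
  by move=> /far_ratio/andP[s0 _]; exact: tail_ge0.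
have q_tail : comparable_on far (fun x y => q y x)
    (fun x y => ((y - x) `^ (- 1 - alpha))%:E * tail (x / (y - x)))%E.
  apply: (cmp_trans q_far_small); apply: cmp_mull => //.
  - by move=> x y _; exact: powR_ge0.
  - by move=> x y /far_ratio/andP[s0 _]; exact: stieltjes_ge0.
  - apply: (cmp_comp (v := fun x _ => x) _ (stieltjes_cmp_tail b1_gt L1)).
    by move=> x y; exact: far_ratio.
split; first split => //.
  apply: cmp_mul => //; [by move=> *; exact: powR_ge0..|].
  exact: cmp_eq.
move=> b2 b2_lt0 U1.
have f_ge0 x y : far x y -> (0 <= (f (x / (y - x)))%:E)%E.
  by move=> /far_ratio/andP[s0 _]; rewrite lee_fin f0'.
split.
  apply: (cmp_trans q_tail).
  apply: (cmp_mull (G := fun x y => (f (x / (y - x)))%:E)) => //.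
    by move=> *; exact: powR_ge0.
  apply: (cmp_comp (v := fun x _ => x) _ (tail_cmp_density L1 b2_lt0 U1)).
  by move=> x y; exact: far_ratio.
apply: (cmp_mul (F := fun x y => (f (x / (y - x)))%:E)
                (G := fun x y => (f (x / y))%:E)) => //.
- by move=> *; exact: powR_ge0.
- by move=> *; exact: powR_ge0.
- by move=> x y fxy; have [_ y0] := far_sub fxy; have [x0 _] := fxy;
    rewrite lee_fin f0' ?divr_gt0.
apply: (density0_cmp L1 b2_lt0 U1) => x y fxy.
have [yx0 y0] := far_sub fxy; have [x0 xy] := fxy.
split; first by rewrite divr_gt0.
- by rewrite ler_pM2l// lef_pV2 ?posrE//; lra.
- rewrite mulrCA ler_pM2l// ler_pdivlMr// mulrC ler_pdivrMr//; lra.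
- by have /andP[_ /le_lt_trans->//] := far_ratio fxy; lra.
Qed.

Lemma q_far_infty (g2 : R) : g2 < 0 -> upper_scaling_oo g2 f ->
  (comparable_on far (fun x y => q x y)
     (fun x y => ((y - x) `^ (- 1 - alpha))%:E * moment ((y - x) / x))%E /\
   comparable_on far
     (fun x y => ((y - x) `^ (- 1 - alpha))%:E * moment ((y - x) / x))%E
     (fun x y => (y `^ (- 1 - alpha))%:E * moment1 (y / x - 1))%E) /\
  (forall g1 : R, - 1 - alpha < g1 -> lower_scaling_oo g1 f ->
   comparable_on far (fun x y => q x y)
     (fun x y => ((y - x) `^ (- 1 - alpha) * (x / (y - x)) `^ (- 1 - alpha) *
                  f ((y - x) / x))%:E) /\
   comparable_on far
     (fun x y => ((y - x) `^ (- 1 - alpha) * (x / (y - x)) `^ (- 1 - alpha) *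
                  f ((y - x) / x))%:E)
     (fun x y => (x `^ (- 1 - alpha) * f (y / x))%:E)).
Proof.
move=> g2_lt0 Uoo.
have q_moment : comparable_on far (fun x y => q x y)
    (fun x y => ((y - x) `^ (- 1 - alpha))%:E * moment ((y - x) / x))%E.
  apply: (cmp_trans q_far_large).
  apply: (@cmp_trans _ _ _ (fun x y => (x `^ (- 1 - alpha))%:E *
      ((((y - x) / x) `^ (- 1 - alpha))%:E * moment ((y - x) / x)))%E).
    apply: cmp_mull.
    - by move=> x y _; exact: powR_ge0.
    - by move=> x y fxy; apply/stieltjes_ge0/(lt_le_trans _ (far_ratioV fxy)).
    - by move=> x y _; rewrite mule_ge0 ?lee_fin ?powR_ge0.
    - apply: (cmp_comp (v := fun x _ => x) _ (stieltjes_cmp_moment g2_lt0 Uoo)).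
      by move=> x y; exact: far_ratioV.
  apply: cmp_eq => x y fxy; have [yx0 _] := far_sub fxy; have [x0 _] := fxy.
  rewrite muleA -EFinM -powRM ?divr_ge0 ?(ltW x0) ?(ltW yx0)//.
  by rewrite (mulrC x) divfK ?gt_eqF.
split; first split => //.
  apply: (@cmp_trans _ _ _ (fun x y => (y `^ (- 1 - alpha))%:E *
      moment1 ((y - x) / x))%E).
    apply: cmp_mul => //; [by move=> *; exact: powR_ge0..|].
    apply: (cmp_comp (v := fun x _ => x) _ moment_cmp).
    by move=> x y; exact: far_ratioV.
  apply: cmp_eq => x y [x0 _]; congr (_ * moment1 _)%E.
  by rewrite mulrBl divff ?gt_eqF.
move=> g1 g1_gt Loo; split.
  apply: (cmp_trans q_moment).
  apply: (@cmp_trans _ _ _ (fun x y => ((y - x) `^ (- 1 - alpha))%:E *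
      ((((y - x) / x)^-1 `^ (- 1 - alpha)) * f ((y - x) / x))%:E)%E).
    apply: cmp_mull => //.
    - by move=> x y _; exact: powR_ge0.
    - move=> x y fxy; rewrite lee_fin mulr_ge0 ?powR_ge0 ?f0'//.
      by rewrite (lt_le_trans _ (far_ratioV fxy)).
    - apply: (cmp_comp (v := fun x _ => x) _
        (moment_cmp_density g2_lt0 Uoo g1_gt Loo)).
      by move=> x y; exact: far_ratioV.
  by apply: cmp_eq => x y _; rewrite -EFinM mulrA invf_div.
apply: (@cmp_trans _ _ _ (fun x y => (x `^ (- 1 - alpha))%:E *
    (f ((y - x) / x))%:E)%E).
  apply: cmp_eq => x y fxy; have [yx0 _] := far_sub fxy; have [x0 _] := fxy.
  rewrite -powRM ?divr_ge0 ?(ltW x0) ?(ltW yx0)//.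
  have -> : (y - x) * (x / (y - x)) = x by rewrite mulrC divfK ?gt_eqF.
  by rewrite EFinM.
apply: (cmp_mull (G := fun x y => (f (y / x))%:E)).
- by move=> x y _; exact: powR_ge0.
- move=> x y fxy; rewrite lee_fin f0'//.
  by rewrite (lt_le_trans _ (far_ratioV fxy)).
- by move=> x y fxy; have [_ y0] := far_sub fxy; have [x0 _] := fxy;
    rewrite lee_fin f0' ?divr_gt0.
apply: (densityoo_cmp g2_lt0 Uoo Loo) => x y fxy.
have [yx0 y0] := far_sub fxy; have [x0 xy] := fxy.
split.
- by apply: le_trans (far_ratioV fxy); rewrite ler1n.
- by rewrite ler_pM2r ?invr_gt0//; lra.
- by rewrite mulrA ler_pM2r ?invr_gt0//; lra.
Qed.

End WeightedIntegrals.

Theorem theorem1p4 (R : realType) (alpha rho : R)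
    (Hperm : permissible alpha rho)
    (phi : probability (measurableTypeR R) R)
    (Hsupp : phi [set` `[0%R, +oo[] = 1%E)
    (f : R -> R) (Hf : positive_density phi f) :
  let q := resurrection_density alpha rho phi in
  let near (x y : R) := 0 < x /\ x <= y <= 5 * x in
  let far (x y : R) := 0 < x /\ 5 * x <= y in
  [/\
      [/\ comparable_on near (fun x y => q x y) (fun x y => q y x),
          comparable_on near (fun x y => q y x)
            (fun x y => (x `^ (- 1 - alpha))%:E)
        & comparable_on near (fun x y => (x `^ (- 1 - alpha))%:E)
            (fun x y => (y `^ (- 1 - alpha))%:E)],

      (forall beta1 : R, - 1 - alpha < beta1 -> lower_scaling0 beta1 f ->
         (comparable_on far (fun x y => q y x)
            (fun x y => ((y - x) `^ (- 1 - alpha))%:E *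
               \int[lebesgue_measure]_(t in `[(x / (y - x))%R, 1%R])
                 (f t / t)%:E)%E /\
          comparable_on far
            (fun x y => ((y - x) `^ (- 1 - alpha))%:E *
               \int[lebesgue_measure]_(t in `[(x / (y - x))%R, 1%R])
                 (f t / t)%:E)%E
            (fun x y => (y `^ (- 1 - alpha))%:E *
               \int[lebesgue_measure]_(t in `[(x / (y - x))%R, 1%R])
                 (f t / t)%:E)%E) /\
         (forall beta2 : R, beta2 < 0 -> upper_scaling0 beta2 f ->
          comparable_on far (fun x y => q y x)
            (fun x y => ((y - x) `^ (- 1 - alpha) * f (x / (y - x)))%:E) /\
          comparable_on far
            (fun x y => ((y - x) `^ (- 1 - alpha) * f (x / (y - x)))%:E)
            (fun x y => (y `^ (- 1 - alpha) * f (x / y))%:E)))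
    &
      (forall gamma2 : R, gamma2 < 0 -> upper_scaling_oo gamma2 f ->
         (comparable_on far (fun x y => q x y)
            (fun x y => ((y - x) `^ (- 1 - alpha))%:E *
               \int[lebesgue_measure]_(t in `]0%R, ((y - x) / x)%R])
                 (t `^ alpha * f t)%:E)%E /\
          comparable_on far
            (fun x y => ((y - x) `^ (- 1 - alpha))%:E *
               \int[lebesgue_measure]_(t in `]0%R, ((y - x) / x)%R])
                 (t `^ alpha * f t)%:E)%E
            (fun x y => (y `^ (- 1 - alpha))%:E *
               \int[lebesgue_measure]_(t in `[1%R, (y / x - 1)%R])
                 (t `^ alpha * f t)%:E)%E) /\
         (forall gamma1 : R, - 1 - alpha < gamma1 ->
            lower_scaling_oo gamma1 f ->
          comparable_on far (fun x y => q x y)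
            (fun x y => ((y - x) `^ (- 1 - alpha) *
               (x / (y - x)) `^ (- 1 - alpha) * f ((y - x) / x))%:E) /\
          comparable_on far
            (fun x y => ((y - x) `^ (- 1 - alpha) *
               (x / (y - x)) `^ (- 1 - alpha) * f ((y - x) / x))%:E)
            (fun x y => (x `^ (- 1 - alpha) * f (y / x))%:E)))].
Proof.
have alpha0 : 0 < alpha.
  by case: Hperm => [[/andP[]]//|[/andP[/(lt_trans ltr01)]]//|[-> _]].
have [mf f0 fE] := Hf.
have f1 :
  (\int[lebesgue_measure]_(t in (`]0%R, +oo[%classic : set R)) (f t)%:E <= 1)%E.
  by rewrite -fE//; exact: probability_le1.
move=> q near far; split.
- exact: (q_near_cmps alpha0 mf f0 f1 Hperm Hf).
- exact: (q_far_zero alpha0 mf f0 f1 Hperm Hf).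
- exact: (q_far_infty alpha0 mf f0 f1 Hperm Hf).
Qed.
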